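(* For any $n\ge1$ and any real $m\ge0$, $C^m_{\mathrm{ap}}(\mathbb{R}^n,\mathbb{R})$ is a closed subspace of the Banach space $C^m_b(\mathbb{R}^n,\mathbb{R})$ and $C^m_{\mathrm{ap}}(\mathbb{R}^n,\mathbb{R})\subseteq c^m_b(\mathbb{R}^n,\mathbb{R})\subseteq C^m_b(\mathbb{R}^n,\mathbb{R})$. Moreover, for $f\in C^m_b(\mathbb{R}^n,\mathbb{R})$ the following are equivalent: (i) $f\in C^m_{\mathrm{ap}}(\mathbb{R}^n,\mathbb{R})$; (ii) for every multi-index $\beta\in\mathbb{Z}^n_{\ge0}$ with $0\le|\beta|\le m$ one has $\partial^\beta f\in C^\gamma_{\mathrm{ap}}(\mathbb{R}^n,\mathbb{R})$, where $\gamma=m-[m]$; (iii) $f$ is a limit in $C^m_b(\mathbb{R}^n,\mathbb{R})$ of a sequence of trigonometric polynomials.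
   Context: $[m]$ is the integer part of $m$. For real $m\ge0$, $C^m_b(\mathbb{R}^n,\mathbb{R})$ is the standard Hölder space: for integer $m$, $C^m$ functions with bounded continuous derivatives of order $\le m$, norm $|f|_m=\max_{|\beta|\le m}\sup|\partial^\beta f|$; for $m=k+\gamma$ ($k$ integer, $0<\gamma<1$), functions in $C^k_b$ with $\gamma$-Hölder derivatives of order $k$, norm $|f|_k+\max_{|\beta|=k}\sup_{x\ne y}|\partial^\beta f(x)-\partial^\beta f(y)|/|x-y|^\gamma$. $C^\infty_b=\bigcap_kC^k_b$, and the little Hölder space $c^m_b(\mathbb{R}^n,\mathbb{R})$ is the closure of $C^\infty_b$ in $C^m_b$. For $f\in C^m_b$, $f_c(x)=f(x+c)$ and $\mathcal S_f=\{f_c\}_{c\in\mathbb{R}^n}$; $C^m_{\mathrm{ap}}(\mathbb{R}^n,\mathbb{R})=\{f\in C^m_b:\mathcal S_f\text{ precompact in }C^m_b\}$. A trigonometric polynomial is a function $\sum_{k=1}^Nc_ke^{i(\Lambda_k,x)_{\mathbb{R}^n}}$ with $c_k\in\mathbb{C}$, $\Lambda_k\in\mathbb{R}^n$. *)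

(* Defs.v *)
From HB Require Import structures.
From mathcomp Require Import all_boot all_order all_algebra.
From mathcomp Require Import all_classical all_reals all_analysis.
Set Implicit Arguments. Unset Strict Implicit. Unset Printing Implicit Defensive.
Import Order.TTheory GRing.Theory Num.Theory.
Import numFieldNormedType.Exports.
Local Open Scope classical_set_scope.
Local Open Scope ring_scope.

Section Holder.
Variables (R : realType) (n : nat).
Notation V := 'rV[R]_n.
Notation fn := (V -> R).

Definition ebas (i : 'I_n) : V := delta_mx 0 i.
Definition dotp (a x : V) : R := \sum_(i < n) a 0 i * x 0 i.
Definition enorm (x : V) : R := Num.sqrt (dotp x x).

Definition pd (i : 'I_n) (f : fn) : fn := fun x => derive f x (ebas i).
Definition dl (s : seq 'I_n) (f : fn) : fn := foldr pd f s.

Definition mlen (b : 'I_n -> nat) : nat := \sum_(i < n) b i.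
Definition dpart (b : 'I_n -> nat) (f : fn) : fn :=
  dl (flatten [seq nseq (b i) i | i <- enum 'I_n]) f.

Definition Ckb (k : nat) (f : fn) : Prop :=
  (forall s : seq 'I_n, (size s <= k)%N -> continuous (dl s f)) /\
  (forall s : seq 'I_n, (size s < k)%N -> forall i x, derivable (dl s f) x (ebas i)) /\
  (exists M : R, forall s : seq 'I_n, (size s <= k)%N -> forall x, `|dl s f x| <= M).

Definition ipart (m : R) : nat := Num.truncn m.
Definition fpart (m : R) : R := m - (ipart m)%:R.

Definition holder (k : nat) (g : R) (f : fn) : Prop :=
  exists M : R, forall b, mlen b = k -> forall x y, x != y ->
    `|dpart b f x - dpart b f y| <= M * powR (enorm (x - y)) g.

Definition Cmb (m : R) (f : fn) : Prop :=
  Ckb (ipart m) f /\ (fpart m = 0 \/ holder (ipart m) (fpart m) f).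

Definition supnorm (k : nat) (f : fn) : R :=
  sup [set r | exists b x, (mlen b <= k)%N /\ r = `|dpart b f x|].
Definition hsemi (k : nat) (g : R) (f : fn) : R :=
  sup [set r | exists b x y, mlen b = k /\ x != y /\
     r = `|dpart b f x - dpart b f y| / powR (enorm (x - y)) g].
Definition hnorm (m : R) (f : fn) : R :=
  supnorm (ipart m) f + (if fpart m == 0 then 0 else hsemi (ipart m) (fpart m) f).

Definition fsub (f g : fn) : fn := fun x => f x - g x.

Definition Cinfb (f : fn) : Prop := forall k, Ckb k f.
Definition littleC (m : R) (f : fn) : Prop :=
  Cmb m f /\ forall e : R, 0 < e -> exists g, Cinfb g /\ hnorm m (fsub f g) < e.

Definition transl (f : fn) (c : V) : fn := fun x => f (x + c).
Definition precompact_translates (m : R) (f : fn) : Prop :=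
  forall e : R, 0 < e -> exists gs : seq fn, (forall g, g \in gs -> Cmb m g) /\
    forall c : V, exists2 g, g \in gs & hnorm m (fsub (transl f c) g) < e.

Definition Cap (m : R) (f : fn) : Prop := Cmb m f /\ precompact_translates m f.

(* trigonometric polynomial sum_k c_k e^{i(Lambda_k,x)}, c_k = a_k + i b_k,
   given as list of ((a_k, b_k), Lambda_k); real and imaginary parts *)
Definition trigpoly := seq ((R * R) * V).
Definition tp_re (p : trigpoly) : fn := fun x =>
  \sum_(t <- p) (t.1.1 * cos (dotp t.2 x) - t.1.2 * sin (dotp t.2 x)).
Definition tp_im (p : trigpoly) : fn := fun x =>
  \sum_(t <- p) (t.1.1 * sin (dotp t.2 x) + t.1.2 * cos (dotp t.2 x)).

End Holder.

(* Main.v *)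
Require Import Defs.
From HB Require Import structures.
From mathcomp Require Import all_boot all_order all_algebra.
From mathcomp Require Import all_classical all_reals all_analysis.
From mathcomp Require Import ring lra zify.
Set Implicit Arguments. Unset Strict Implicit. Unset Printing Implicit Defensive.
Import Order.TTheory GRing.Theory Num.Theory.
Import numFieldNormedType.Exports.
Local Open Scope classical_set_scope.
Local Open Scope ring_scope.

(** The heart is that a function with precompact translates is approximated by
    trigonometric polynomials. The displacement [c |-> |f_c - f|] is a continuous
    totally bounded pseudo-norm on R^n. By Bogolyubov's argument (finite Fourier
    analysis on Z/4N, then compactness as N grows, then one axis at a time) it is small
    wherever finitely many [cos (l . c)] are close to 1. A large power of the sum of the
    [1 + cos (l . c)] is then a nonnegative trigonometric kernel K concentrated on
    small displacements, and the mean over [c] of [K c * f_c] is a trigonometric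
    polynomial close to [f]. The mean is the limit of finite averages, for which the
    C^m estimate is immediate; it passes to the limit because iterated derivatives are
    limits of iterated difference quotients, which also gives their symmetry. The other
    claims are statements on totally bounded families of balls. *)

(** * Bogolyubov's lemma *)

(** What makes compactness applicable is a count that does not depend on the range: a net of [k]
    displacements produces at most [32 * k ^ 2] frequencies for every [N], so they all live in one
    cube of fixed dimension. The set [A - A + A - A] is used instead of [A - A] because its weight
    is the square of [F = |A^|^2]: the total of [F] is known by Parseval, so discarding the
    frequencies where [F] is small costs only a fraction of the term at 0. Continuity of the
    displacement is a real obstacle, since translation is not continuous on [C^m_b]; it has to be
    extracted from total boundedness. A second obstacle is that finite averages approach the
    trigonometric polynomial in the sup norm only, so every [C^m] estimate must be one that survives
    uniform limits. Means are built from finite averages alone, without measure or Bohr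
    compactification. *)

Lemma cos_progression (R : realType) (t : R) (P : nat) :
  sin (t / 2) * (\sum_(x < P) cos (x%:R * t)) * 2 =
  sin (P%:R * t - t / 2) + sin (t / 2).
Proof.
elim: P => [|P IH]; first by rewrite big_ord0 mulr0 !mul0r sub0r sinN addNr.
rewrite big_ord_recr /= (mulrDr (sin _)) mulrDl IH.
have -> : P.+1%:R * t - t / 2 = P%:R * t + t / 2 by rewrite -natr1; field.
rewrite sinB sinD; ring.
Qed.

(** With [P t = 2 pi d] the two boundary sines of the telescoped sum cancel, and the factor
    [sin (t / 2)] is nonzero because [0 < t / 2 < pi]. *)
Lemma cos_sum_eq0 (R : realType) (P d : nat) : (0 < d < P)%N ->
  \sum_(x < P) cos (x%:R * ((pi *+ 2) / P%:R * d%:R)) = 0 :> R.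
Proof.
move=> /andP[d0 dP].
have P0 : (0 : R) < P%:R by rewrite ltr0n; lia.
set t : R := _ * d%:R.
have H := cos_progression t P.
have tE : P%:R * t - t / 2 = - (t / 2) + pi *+ 2 *+ d.
  rewrite /t -(mulr_natr _ d); move: (pi *+ 2) => p.
  by field; rewrite gt_eqF.
move: H; rewrite tE (periodicn (@sinD2pi R)) sinN addNr => /eqP.
rewrite !mulf_eq0 pnatr_eq0 orbF => /orP[/eqP s0|/eqP //].
have : 0 < sin (t / 2).
  have -> : t / 2 = pi * (d%:R / P%:R).
    by rewrite /t -mulr_natr; move: pi => p; field; rewrite gt_eqF.
  apply: sin_gt0_pi; rewrite mulr_gt0 ?pi_gt0 //=; last by rewrite divr_gt0 // ltr0n.
  by rewrite gtr_pMr ?pi_gt0 // ltr_pdivrMr // mul1r ltr_nat.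
by rewrite s0 ltxx.
Qed.

Lemma cos_sum_int_eq0 (R : realType) (P : nat) (z : int) :
  z != 0 -> (`|z| < P)%N ->
  \sum_(x < P) cos (x%:R * ((pi *+ 2) / P%:R * z%:~R)) = 0 :> R.
Proof.
move=> z0 zP; rewrite -[RHS](@cos_sum_eq0 R P `|z|); last by rewrite zP absz_gt0 z0.
apply: eq_bigr => x _; case: z {z0 zP} => k //=.
by rewrite NegzE intrN !mulrN cosN.
Qed.

(* The sines cancel by antisymmetry in [a] and [b]. *)
Lemma sum_cos_diff_mul (R : realType) (I : finType) (A : {set I}) (u : I -> R) y :
  (\sum_(a in A) \sum_(b in A) cos (u a - u b)) * cos y =
  \sum_(a in A) \sum_(b in A) cos (u a - u b + y).
Proof.
have S0 : \sum_(a in A) \sum_(b in A) sin (u a - u b) = 0.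
  set S := LHS; have : S = - S.
    rewrite {1}/S exchange_big -sumrN; apply: eq_bigr => a _.
    by rewrite -sumrN; apply: eq_bigr => b _; rewrite -sinN opprB.
  by lra.
transitivity (\sum_(a in A) \sum_(b in A) cos (u a - u b) * cos y -
  (\sum_(a in A) \sum_(b in A) sin (u a - u b)) * sin y).
  by rewrite S0 mul0r subr0 big_distrl; apply: eq_bigr => a _; rewrite big_distrl.
rewrite big_distrl /= -sumrB; apply: eq_bigr => a _.
rewrite big_distrl /= -sumrB; apply: eq_bigr => b _.
by rewrite [RHS]cosD.
Qed.

(** The double sum is the squared modulus of the exponential sum over [A], written as cosine part
    squared plus sine part squared. *)
Lemma sum_cos_diff_ge0 (R : realType) (I : finType) (A : {set I}) (u : I -> R) :
  0 <= \sum_(a in A) \sum_(b in A) cos (u a - u b).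
Proof.
have -> : \sum_(a in A) \sum_(b in A) cos (u a - u b) =
   (\sum_(a in A) cos (u a)) * (\sum_(a in A) cos (u a)) +
   (\sum_(a in A) sin (u a)) * (\sum_(a in A) sin (u a)).
  rewrite !big_distrlr -big_split; apply: eq_bigr => a _.
  by rewrite -big_split; apply: eq_bigr => b _; rewrite cosB.
by rewrite -!expr2 addr_ge0 // sqr_ge0.
Qed.

(* Fourier analysis on Z/4N: the spectrum of A is large at few frequencies, and
   if [-c] were not in A - A + A - A then the sum of [|A^|^4] against the
   character of [c] would vanish, although its term at 0 dominates. *)
Lemma bogolyubov_finite (R : realType) (N k : nat) (A : {set 'I_N}) :
  (0 < N)%N -> (N <= #|A| * k)%N ->
  exists s : seq R, [/\ (size s <= 32 * k ^ 2)%N,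
    forall t, t \in s -> 0 <= t <= pi *+ 2 &
    forall c : nat, (c <= N)%N -> (forall t, t \in s -> 0 <= cos (t * c%:R)) ->
    exists a b a' b', [/\ a \in A, b \in A, a' \in A & b' \in A] /\
      (Posz a - Posz b + (Posz a' - Posz b') + Posz c = 0)].
Proof.
move=> N0 NA.
(* The modulus exceeds [|a - b + a' - b' + c|] for all points considered, so a character sum over
   Z/P vanishes unless that integer is itself 0: there is no wrap-around. *)
pose P := (4 * N)%N; have P0 : (0 < P)%N by rewrite muln_gt0.
have PR : (0 : R) < P%:R by rewrite ltr0n.
pose w : R := pi *+ 2 / P%:R.
have w0 : 0 <= w by apply: divr_ge0 => //; apply: mulrn_wge0; exact: pi_ge0.
pose u (x : 'I_P) (a : 'I_N) : R := x%:R * (w * a%:R).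
pose F (x : 'I_P) := \sum_(a in A) \sum_(b in A) cos (u x a - u x b).
pose al : R := #|A|%:R.
have A0 : (0 < #|A|)%N by case: posnP NA => // ->; rewrite mul0n leqNgt N0.
have al0 : 0 < al by rewrite ltr0n.
have F0 x : 0 <= F x by exact: sum_cos_diff_ge0.
have orth (z : int) : z != 0 -> (`|z| < P)%N ->
    \sum_(x < P) cos (x%:R * (w * z%:~R)) = 0 by exact: cos_sum_int_eq0.
(* Parseval: only the diagonal pairs survive the summation over characters. *)
have sumF : \sum_x F x = P%:R * al.
  rewrite /F exchange_big /=.
  transitivity (\sum_(a in A) (P%:R : R)); last first.
    by rewrite sumr_const mulr_natr.
  apply: eq_bigr => a aA; rewrite exchange_big /= (bigD1 a) //=.
  rewrite [X in X + _](_ : _ = P%:R); last first.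
    rewrite (eq_bigr (fun=> 1)); last by move=> x _; rewrite subrr cos0.
    by rewrite sumr_const card_ord.
  rewrite big1 ?addr0 // => b /andP[bA ba].
  rewrite -[RHS](orth (Posz a - Posz b)).
  - by apply: eq_bigr => x _; rewrite intrB /u; congr cos; ring.
  - by rewrite subr_eq0 eqz_nat eq_sym.
  - by have := ltn_ord a; have := ltn_ord b; rewrite /P; lia.
pose x0 : 'I_P := Ordinal P0.
have Fx0 : F x0 = al ^+ 2.
  rewrite /F (eq_bigr (fun=> al)); first by rewrite sumr_const -mulr_natr expr2.
  move=> a _; rewrite (eq_bigr (fun=> 1)) ?sumr_const // => b _.
  by rewrite /u !mul0r subr0 cos0.
(* The frequencies with [F < tau] contribute at most [tau * (P * al) = al ^+ 4 / 2] in absolute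
   value, half of the term at frequency 0. *)
pose tau : R := al ^+ 3 / (2 * P%:R).
have tau0 : 0 < tau by rewrite divr_gt0 ?exprn_gt0 ?mulr_gt0.
pose G := [set x | tau <= F x]%SET.
exists [seq x%:R * w | x : 'I_P <- enum G]; split.
- rewrite size_map -cardE -(ler_nat R).
  (* Markov's inequality on [sumF] gives [#|G| <= 2 P^2 / al^2]; then [P = 4 N] and [N <= al * k]
     give [32 k^2]. *)
  have H1 : #|G|%:R * tau <= P%:R * al.
    rewrite -sumF (bigID (mem G)) /= -[X in X <= _]addr0 lerD //; last exact: sumr_ge0.
    rewrite mulr_natl -sumr_const; apply: ler_sum => x.
    by rewrite inE.
  have H2 : (N%:R : R) <= al * k%:R by rewrite -natrM ler_nat.
  have H3 : #|G|%:R * al ^+ 2 <= 2 * P%:R ^+ 2.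
    have -> : #|G|%:R * al ^+ 2 = #|G|%:R * tau * (2 * P%:R / al).
      by rewrite /tau; field; rewrite !gt_eqF.
    have -> : 2 * P%:R ^+ 2 = P%:R * al * (2 * P%:R / al) by field; rewrite gt_eqF.
    by rewrite ler_wpM2r // divr_ge0 ?mulr_ge0 // ltW.
  have H4 : (P%:R : R) = 4 * N%:R by rewrite /P natrM.
  rewrite -(ler_pM2r (exprn_gt0 2 al0)); apply: (le_trans H3).
  rewrite H4 natrM natrX.
  have N0' : (0 : R) <= N%:R by [].
  have : (N%:R : R) ^+ 2 <= (al * k%:R) ^+ 2 by rewrite lerXn2r ?nnegrE // mulr_ge0 // ltW.
  nra.
- move=> t /mapP[x _ ->]; rewrite mulr_ge0 //=.
  have p0 : 0 < (pi *+ 2 : R) by have := @pi_gt0 R; move: (pi : R) => p; lra.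
  rewrite /w mulrCA ger_pMr //.
  by rewrite ler_pdivrMr // mul1r ler_nat ltnW.
move=> c cN Hc; apply: contrapT => Hno.
pose y (x : 'I_P) : R := x%:R * (w * c%:R).
have S0 : \sum_x F x * (F x * cos (y x)) = 0.
  have E x : F x * (F x * cos (y x)) = \sum_(a in A) \sum_(b in A)
      \sum_(a' in A) \sum_(b' in A) cos (u x a' - u x b' + (u x a - u x b + y x)).
    rewrite {2}/F sum_cos_diff_mul big_distrr; apply: eq_bigr => a _.
    rewrite big_distrr; apply: eq_bigr => b _.
    by rewrite /F /= sum_cos_diff_mul.
  rewrite (eq_bigr _ (fun x _ => E x)) exchange_big big1 // => a aA.
  rewrite exchange_big big1 // => b bA; rewrite exchange_big big1 // => a' aA'.
  rewrite exchange_big big1 // => b' bA'.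
  rewrite -[RHS](orth (Posz a - Posz b + (Posz a' - Posz b') + Posz c)).
  - by apply: eq_bigr => x _; rewrite !(intrD, intrB) /u /y; congr cos; ring.
  - by apply/eqP => z0; apply: Hno; exists a, b, a', b'.
  - have := ltn_ord a; have := ltn_ord b; have := ltn_ord a'; have := ltn_ord b'.
    by rewrite /P; lia.
(* On the large spectrum the cosine is nonnegative by assumption; elsewhere [F x <= tau] and the
   cosine is at least -1. *)
have lb x : - (tau * F x) <= F x * (F x * cos (y x)).
  case: (boolP (x \in G)) => xG.
    rewrite (@le_trans _ _ 0) ?oppr_le0 ?mulr_ge0 ?(ltW tau0) ?F0 //.
    have := Hc (x%:R * w); rewrite -mulrA; apply; apply/mapP; exists x => //.
    by rewrite mem_enum.
  have Ft : F x <= tau by move: xG; rewrite inE -ltNge => /ltW.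
  have c1 := cos_geN1 (y x).
  have : - (F x * F x) <= F x * (F x * cos (y x)).
    by rewrite -mulrN ler_wpM2l // -[X in X <= _]mulr1 mulNr -mulrN ler_wpM2l.
  apply: le_trans; rewrite lerN2 ler_wpM2r //.
have : al ^+ 4 - tau * (P%:R * al) <= 0.
  rewrite -S0 -sumF (bigD1 x0) //= [X in _ <= X](bigD1 x0) //=.
  have -> : y x0 = 0 by rewrite /y mul0r.
  rewrite cos0 mulr1 mulrDr opprD addrA lerD //.
    rewrite Fx0 -exprD gerBl mulr_ge0 ?exprn_ge0 ?(ltW al0) ?(ltW tau0) //.
  rewrite mulr_sumr -sumrN; apply: ler_sum => x _; exact: lb.
have -> : tau * (P%:R * al) = al ^+ 4 / 2 by rewrite /tau; field; rewrite gt_eqF.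
have : 0 < al ^+ 4 by rewrite exprn_gt0.
lra.
Qed.

(* [B e c] reads "the translation by [c] is at distance at most [e] from the identity";
   no norm is required, only a symmetric and subadditive family of balls. *)
Definition balls (R : realType) (U : zmodType) (B : R -> U -> Prop) :=
  [/\ forall e, 0 <= e -> B e 0, forall e c, B e c -> B e (- c) &
      forall a b c d, B a c -> B b d -> B (a + b) (c + d)].

Definition totally_bounded (R : realType) (U : zmodType) (B : R -> U -> Prop) :=
  forall e : R, 0 < e ->
  exists cs : seq U, forall c, exists2 c', c' \in cs & B e (c - c').

Lemma ballsW (R : realType) (U : zmodType) (B : R -> U -> Prop) a b c :
  balls B -> a <= b -> B a c -> B b c.
Proof.
move=> [B0 _ BD] ab Bc; rewrite -(addr0 c) -(subrK a b) addrC.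
by apply: BD => //; apply: B0; rewrite subr_ge0.
Qed.

Lemma ballsB (R : realType) (U : zmodType) (B : R -> U -> Prop) a b c d :
  balls B -> B a c -> B b d -> B (a + b) (c - d).
Proof. by move=> [_ BN BD] Bc /BN; exact: BD. Qed.

(** Pigeonhole by double counting; the classes may overlap. It supplies the set of density
    [1 / size cs] on which Bogolyubov's argument runs. *)
Lemma large_class (T : eqType) (N : nat) (cs : seq T) (Q : 'I_N -> T -> Prop) :
  (0 < N)%N -> (forall z, exists2 c, c \in cs & Q z c) ->
  exists2 c, c \in cs &
    (N <= #|[set z | `[< Q z c >]]%SET| * size cs)%N.
Proof.
move=> N0 H; apply: contrapT => Hno.
pose A c := [set z | `[< Q z c >]]%SET.
have h1 : (N <= \sum_(c <- cs) #|A c|)%N.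
  have -> : (\sum_(c <- cs) #|A c| = \sum_(z : 'I_N) \sum_(c <- cs) (z \in A c))%N.
    rewrite exchange_big; apply: eq_bigr => c _ /=.
    by rewrite -sum1_card big_mkcond; apply: eq_bigr => z _; case: (z \in A c).
  rewrite -[X in (X <= _)%N](card_ord N) -sum1_card; apply: leq_sum => z _.
  have [c cs_c Qc] := H z.
  rewrite (big_rem c) //= inE asboolT // leq_addr //.
have h2 : (\sum_(c <- cs) (#|A c| * size cs) <= \sum_(c <- cs) N.-1)%N.
  rewrite big_seq [X in (_ <= X)%N]big_seq; apply: leq_sum => c cc.
  rewrite -ltnS prednK // ltnNge; apply/negP => h; apply: Hno; exists c => //.
rewrite -big_distrl /= big_const_seq count_predT iter_addn_0 in h2.
have [c cc _] := H (Ordinal N0).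
have cs0 : (0 < size cs)%N by case: (cs) cc.
move: h2; rewrite leq_pmul2r // => h2; have := leq_trans h1 h2.
by rewrite leqNgt prednK // leqnn.
Qed.

(** Two members of one class of an [e / 4] net differ by a displacement of size at most [e / 2], and
    [- c] is a sum of two such differences. The quantifier order matters: [r] comes from the net and
    is fixed before [N]. *)
Lemma bogolyubov_int_upto (R : realType) (B : R -> int -> Prop) :
  balls B -> totally_bounded B -> forall e : R, 0 < e ->
  exists r, forall N, exists v : 'rV[R]_r, (forall j, v 0 j \in `[0, pi *+ 2]) /\
    forall c : nat, (c <= N)%N -> (forall j, 0 <= cos (v 0 j * c%:R)) -> B e c.
Proof.
move=> bB tB e e0.
have e4 : 0 < e / 4 by rewrite divr_gt0.
have [cs Hcs] := tB _ e4; exists (32 * size cs ^ 2)%N => N.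
have [c' c'cs NA] := @large_class _ N.+1 cs
  (fun (z : 'I_N.+1) c => B (e / 4) (Posz z - c)) (ltn0Sn N) (fun z => Hcs (Posz z)).
have [s [ss s2 H]] := bogolyubov_finite R (ltn0Sn N) NA.
(* The list is padded to length [r] with the frequency 0, which imposes no condition since
   [cos 0 = 1]. *)
exists (\row_j nth 0 s j); split.
  move=> j; rewrite mxE in_itv /=.
  have [js|js] := ltnP j (size s); first by rewrite s2 // mem_nth.
  by rewrite nth_default // lexx mulrn_wge0 // pi_ge0.
move=> c cN Hc.
have [||a [b [a' [b' [[]]]]]] := H c; first by rewrite leqW.
  move=> t ts; have it : (index t s < 32 * size cs ^ 2)%N.
    by rewrite (leq_trans _ ss) // index_mem.
  by have := Hc (Ordinal it); rewrite mxE /= nth_index.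
rewrite !inE => /asboolP Ba /asboolP Bb /asboolP Ba' /asboolP Bb' E.
have -> : Posz c = - ((Posz a - c' - (Posz b - c')) + (Posz a' - c' - (Posz b' - c'))).
  by apply/eqP; rewrite -subr_eq0 opprK -E; apply/eqP; ring.
have -> : e = e / 4 + e / 4 + (e / 4 + e / 4) by field.
by case: (bB) => _ BN BD; apply/BN/BD; apply: ballsB => //; apply/asboolP.
Qed.

(** Take a cluster point of the frequency vectors as [N] grows. The strict inequality there is an
    open condition, so it holds at the vector of some [N >= |c|], where the weak inequality
    suffices. *)
Lemma bogolyubov_int (R : realType) (B : R -> int -> Prop) :
  balls B -> totally_bounded B -> forall e : R, 0 < e ->
  exists r, exists th : 'I_r -> R,
    forall c : int, (forall j, 0 < cos (th j * c%:~R)) -> B e c.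
Proof.
move=> bB tB e e0; have [r H] := bogolyubov_int_upto bB tB e0.
have [v Hv] := choice H.
have cpt := @rV_compact R r (fun=> `[0, pi *+ 2]%classic) (fun=> @segment_compact _ _ _).
have [|th [_ clth]] := cpt (v @ \oo) _.
  by exists 0%N => // N _ j; exact: (Hv N).1.
exists r, (fun j => th 0 j) => c Hc.
suff : B e (Posz `|c|%N).
  case: c {Hc} => k //= Bk; rewrite NegzE; case: bB => _ BN _; exact: BN.
have Hc' j : 0 < cos (th 0 j * `|c|%:R).
  by case: c Hc => k // Hc; have := Hc j; rewrite NegzE intrN mulrN cosN.
have nb : nbhs th [set v : 'rV[R]_r | forall j, 0 < cos (v 0 j * `|c|%:R)].
  apply: (@filter_forall _ _ (fun j (v : 'rV[R]_r) => 0 < cos (v 0 j * `|c|%:R)) _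
    (nbhs_filter th)) => j.
  have ct : {for th, continuous (fun v : 'rV[R]_r => cos (v 0 j * `|c|%:R))}.
    apply: (@continuous_comp _ _ _ (fun v : 'rV[R]_r => v 0 j) (fun x => cos (x * `|c|%:R))).
      exact: coord_continuous.
    apply: (@continuous_comp _ _ _ (fun x : R => x * `|c|%:R) cos).
      by apply: cvgM; [exact: cvg_id|exact: cvg_cst].
    exact: continuous_cos.
  by move/cvgr_gt: ct => /(_ _ (Hc' j)).
have [|x [[N cN <-] Hx]] := clth (v @` [set N | (`|c| <= N)%N]) _ _ nb.
  by exists `|c|%N => // N /= cN; exists N.
apply: (Hv N).2 => // j; apply: ltW; exact: Hx.
Qed.

(** * Bohr neighbourhoods *)

Lemma cos_lipschitz (R : realType) (x y : R) : `|cos x - cos y| <= `|x - y|.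
Proof.
wlog xy : x y / y <= x.
  move=> H; case: (leP y x) => [/H//|/ltW/H]; rewrite distrC => /le_trans; apply.
  by rewrite distrC.
have ct : {within `[y, x], continuous (@cos R)}.
  by apply: continuous_subspaceT; exact: continuous_cos.
have [z _ ->] := MVT_segment xy (fun z _ => is_derive_cos z) ct.
by rewrite normrM normrN ler_piMl // sin_max.
Qed.

Lemma cosDint (R : realType) (x : R) (z : int) : cos (x + pi *+ 2 * z%:~R) = cos x.
Proof.
case: z => k; first by rewrite mulr_natr (periodicn (@cosD2pi R)).
rewrite NegzE intrN mulrN mulr_natr -[in RHS](subrK (pi *+ 2 *+ k.+1) x).
by rewrite (periodicn (@cosD2pi R)).
Qed.

(** Rounding leaves a remainder [s <= 1 / 2], so [pi *+ 2 * s] lies in [[0, pi]], where the cosine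
    decreases. The frequency [2 pi] thus detects nearness to the integers. *)
Lemma near_int_of_cos (R : realType) (eta t : R) : 0 < eta < 1 / 2 ->
  cos (pi *+ 2 * eta) < cos (pi *+ 2 * t) -> exists z : int, `|t - z%:~R| < eta.
Proof.
move=> /andP[eta0 eta1] H; exists (Num.floor (t + 1 / 2)); set z := Num.floor _.
have zt : (z%:~R : R) <= t + 1 / 2 by exact: floor_le.
have tz : t + 1 / 2 < (z + 1)%:~R :> R by exact: floorD1_gt.
rewrite intrD mulr1z in tz.
pose s := `|t - z%:~R|.
have s2 : s <= 1 / 2 by rewrite ler_norml; apply/andP; split; lra.
have E : cos (pi *+ 2 * t) = cos (pi *+ 2 * s).
  rewrite -[LHS](cosDint _ (- z)) -[LHS]cos_norm intrN -mulrDr normrM ger0_norm //.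
  by rewrite mulrn_wge0 // pi_ge0.
rewrite ltNge; apply/negP => etas; move: H; rewrite E ltNge => /negP; apply.
have p0 := @pi_gt0 R; move: (@ltr_cos R) => mono.
have le_cos : {in `[0, pi] &, {mono (@cos R) : x y /~ y <= x}}.
  by move=> x y xi yi; rewrite !leNgt mono.
have pp0 : 0 < (pi *+ 2 : R) by move: (pi : R) p0 => p; lra.
rewrite le_cos //; rewrite ?in_itv /=.
- by rewrite ler_pM2l.
- by apply/andP; split; move: (pi : R) p0 => p p0; rewrite -mulr_natl; nra.
- have s0 : 0 <= s by rewrite normr_ge0.
  by apply/andP; split; move: (pi : R) p0 => p p0; rewrite -mulr_natl; nra.
Qed.

(** Net points of [W] may lie outside the image of [phi]; each is replaced by a preimage within
    [e / 2], which doubles the radius. The default 0 of [xget] is met only for net points that serve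
    no [t]. *)
Lemma totally_bounded_preim (R : realType) (U W : zmodType) (phi : U -> W)
    (B : R -> W -> Prop) :
  (forall a b, phi (a - b) = phi a - phi b) -> balls B -> totally_bounded B ->
  totally_bounded (fun e c => B e (phi c)).
Proof.
move=> phiB bB tB e e0; have e2 : 0 < e / 2 by rewrite divr_gt0.
have [cs Hcs] := tB _ e2.
pose good c := [set t | B (e / 2) (phi t - c)].
exists [seq xget 0 (good c) | c <- cs] => t; have [c cc Bc] := Hcs (phi t).
exists (xget 0 (good c)); first exact: map_f.
have Br : good c (xget 0 (good c)) by apply: xgetPex; exists t.
by have := ballsB bB Bc Br; rewrite -splitr opprB addrA subrK phiB.
Qed.

(** The frequency [2 pi] forces [t] near an integer [z]; the integer case handles [z], continuity at
    0 handles [t - z]. *)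
Lemma bohr_line (R : realType) (B : R -> R -> Prop) :
  balls B -> totally_bounded B ->
  (forall e : R, 0 < e -> exists2 d : R, 0 < d & forall t, `|t| < d -> B e t) ->
  forall e : R, 0 < e -> exists s : seq R, exists2 kap : R, kap < 1 &
    forall t, (forall th, th \in s -> kap < cos (th * t)) -> B e t.
Proof.
move=> bB tB cB e e0; have e2 : 0 < e / 2 by rewrite divr_gt0.
pose B' (a : R) (z : int) := B a z%:~R.
have bB' : balls B'.
  case: bB => B0 BN BD; split; rewrite /B'; first by move=> *; exact: B0.
    by move=> a z; rewrite intrN; exact: BN.
  by move=> a b z z'; rewrite intrD; exact: BD.
have tB' : totally_bounded B'.
  by apply: totally_bounded_preim bB tB => a b; exact: intrB.
have [r [th Hth]] := bogolyubov_int bB' tB' e2.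
have [d d0 Hd] := cB _ e2.
pose S : R := \sum_j `|th j|.
have S0 : 0 <= S by exact: sumr_ge0.
(* [eta < 1 / 2] allows rounding, [eta <= d] allows continuity, and [S * eta < 1 / 2] prevents a
   cosine above 1/2 at [t] from dropping to 0 at [z]. *)
pose eta : R := Num.min (1 / 4) (Num.min d (1 / 2 / (S + 1))).
have eta0 : 0 < eta by rewrite !lt_min d0 !divr_gt0 // ltr_pwDr.
have eta1 : eta < 1 / 2.
  by apply: (@le_lt_trans _ _ (1 / 4)); [rewrite ge_min lexx|lra].
exists (pi *+ 2 :: [seq th j | j <- enum 'I_r]).
exists (Num.max (1 / 2) (cos (pi *+ 2 * eta))).
  rewrite gt_max; apply/andP; split; first lra.
  rewrite -(@cos0 R) ltr_cos ?in_itv /=.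
  - by apply: mulr_gt0 => //; have := @pi_gt0 R; move: (pi : R) => p; lra.
  - by rewrite lexx pi_ge0.
  - have := @pi_gt0 R; move: (pi : R) => p p0; rewrite -mulr_natl.
    by apply/andP; split; nra.
move=> t Ht.
have [||z zt] := @near_int_of_cos R eta t.
- by rewrite eta0.
- by have := Ht _ (mem_head _ _); rewrite gt_max => /andP[].
have Bz : B (e / 2) z%:~R.
  apply: Hth => j.
  have : th j \in [seq th j | j <- enum 'I_r] by apply: map_f; rewrite mem_enum.
  move=> thj; have := Ht (th j); rewrite inE thj orbT => /(_ isT).
  rewrite gt_max => /andP[h _].
  have := cos_lipschitz (th j * t) (th j * z%:~R).
  rewrite -mulrBr normrM => h2.
  have h3 : `|th j| <= S.
    by rewrite /S (bigD1 j) //= lerDl sumr_ge0.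
  have h4 : `|th j| * `|t - z%:~R| <= S * eta by rewrite ler_pM // ltW.
  have h5 : S * eta < 1 / 2.
    have : eta <= 1 / 2 / (S + 1) by rewrite !ge_min lexx !orbT.
    rewrite ler_pdivlMr; last by rewrite ltr_pwDr.
    by nra.
  have := ler_norm (cos (th j * t) - cos (th j * z%:~R)).
  lra.
have Bt : B (e / 2) (t - z%:~R).
  by apply: Hd; apply: (lt_le_trans zt); rewrite !ge_min lexx !orbT.
case: bB => _ _ BD.
by have := BD _ _ _ _ Bt Bz; rewrite subrK -splitr.
Qed.

Lemma dotpZdelta (R : realType) (n : nat) (a : R) (i : 'I_n) (x : 'rV[R]_n) :
  dotp (a *: ebas R i) x = a * x 0 i.
Proof.
rewrite /dotp (bigD1 i) //= big1 ?addr0; first by rewrite !mxE !eqxx mulr1.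
by move=> j ji; rewrite !mxE (negPf ji) andbF mulr0 mul0r.
Qed.

Lemma row_sum_ebas (R : realType) (n : nat) (x : 'rV[R]_n) :
  x = \sum_(i < n) x 0 i *: ebas R i.
Proof. exact: row_sum_delta. Qed.

Lemma balls_sum (R : realType) (U : zmodType) (B : R -> U -> Prop) (I : Type)
    (r : seq I) (e : I -> R) (c : I -> U) :
  balls B -> (forall i, B (e i) (c i)) -> B (\sum_(i <- r) e i) (\sum_(i <- r) c i).
Proof.
move=> [B0 _ BD] H; elim: r => [|i r IH]; first by rewrite !big_nil; exact: B0.
by rewrite !big_cons; exact: BD.
Qed.

(** A frequency [th *: ebas R i] sees only coordinate [i], so the conditions for the axes merge into
    one list; [c] is the sum of its coordinate parts, each within [e / n.+1]. *)
Lemma bohr_space (R : realType) (n : nat) (B : R -> 'rV[R]_n -> Prop) :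
  balls B -> totally_bounded B ->
  (forall e : R, 0 < e -> exists2 d : R, 0 < d & forall c, `|c| < d -> B e c) ->
  forall e : R, 0 < e -> exists s : seq 'rV[R]_n, exists2 kap : R, kap < 1 &
    forall c, (forall l, l \in s -> kap < cos (dotp l c)) -> B e c.
Proof.
move=> bB tB cB e e0; pose e' := e / n.+1%:R.
have e'0 : 0 < e' by rewrite divr_gt0.
have H (i : 'I_n) : exists p : seq R * R, p.2 < 1 /\
    forall t, (forall th, th \in p.1 -> p.2 < cos (th * t)) -> B e' (t *: ebas R i).
  pose Bi (a t : R) := B a (t *: ebas R i).
  have bBi : balls Bi.
    case: bB => B0 BN BD; split; rewrite /Bi.
    - by move=> a a0; rewrite scale0r; exact: B0.
    - by move=> a t; rewrite scaleNr; exact: BN.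
    - by move=> a b s t; rewrite scalerDl; exact: BD.
  have tBi : totally_bounded Bi.
    by apply: totally_bounded_preim bB tB => a b; exact: scalerBl.
  have cBi a : 0 < a -> exists2 d, 0 < d & forall t, `|t| < d -> Bi a t.
    move=> /cB[d d0 Hd]; pose M := `|ebas R i| + 1.
    have M0 : 0 < M by rewrite ltr_pwDr.
    exists (d / M); first by rewrite divr_gt0.
    move=> t; rewrite ltr_pdivlMr // => tM; apply: Hd; rewrite normrZ.
    by apply: le_lt_trans tM; rewrite ler_wpM2l // lerDl.
  by have [s [kap k1 Hs]] := bohr_line bBi tBi cBi e'0; exists (s, kap).
have [p Hp] := choice H.
exists [seq th *: ebas R i | i <- enum 'I_n, th <- (p i).1].
exists (\big[Num.max/0]_(i < n) (p i).2).
  by elim/big_ind: _ => // [x y x1 y1|i _]; [rewrite gt_max x1|exact: (Hp i).1].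
move=> c Hc; rewrite (row_sum_ebas c).
have Bi i : B e' (c 0 i *: ebas R i).
  apply: (Hp i).2 => th thp; rewrite -dotpZdelta.
  apply: le_lt_trans (Hc _ _); first by rewrite (bigD1 i) //= le_max lexx.
  by apply/allpairsPdep; exists i, th; rewrite mem_enum.
apply: ballsW bB _ (balls_sum (index_enum _) bB Bi).
rewrite sumr_const card_ord -mulr_natl /e' mulrA ler_pdivrMr //.
by rewrite mulrC ler_pM2l // ler_nat.
Qed.

(** * Means of almost periodic functions *)

Lemma totally_bounded_and (R : realType) (U : zmodType) (B C : R -> U -> Prop) :
  balls B -> balls C -> totally_bounded B -> totally_bounded C ->
  totally_bounded (fun e c => B e c /\ C e c).
Proof.
move=> bB bC tB tC e e0; have e2 : 0 < e / 2 by rewrite divr_gt0.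
have [cs Hcs] := tB _ e2; have [ds Hds] := tC _ e2.
pose good (p : U * U) := [set x | B (e / 2) (x - p.1) /\ C (e / 2) (x - p.2)].
exists [seq xget 0 (good (c, d)) | c <- cs, d <- ds] => c.
have [c' c's Bc] := Hcs c; have [d' d's Cc] := Hds c.
exists (xget 0 (good (c', d'))); first by apply/allpairsP; exists (c', d').
have [|Bx Cx] := @xgetPex _ 0 (good (c', d')); first by exists c.
have := ballsB bB Bc Bx; have := ballsB bC Cc Cx.
by rewrite -!splitr !opprB !addrA !subrK.
Qed.

Lemma totally_bounded_all (R : realType) (U : zmodType) (I : eqType) (r : seq I)
    (B : I -> R -> U -> Prop) :
  (forall i, i \in r -> balls (B i)) -> (forall i, i \in r -> totally_bounded (B i)) ->
  totally_bounded (fun e c => forall i, i \in r -> B i e c).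
Proof.
elim: r => [|i r IH] bB tB.
  by move=> e e0; exists [:: 0] => c; exists 0; [exact: mem_head|].
have rr j : j \in r -> j \in i :: r by move=> jr; rewrite inE jr orbT.
have bA : balls (fun e c => forall i, i \in r -> B i e c).
  split=> [e e0 j jr|e c H j jr|a b c d H K j jr]; case: (bB _ (rr _ jr)) => B0 BN BD.
  - exact: B0.
  - exact/BN/H.
  - by apply: BD; [exact: H|exact: K].
have tA : totally_bounded (fun e c => forall i, i \in r -> B i e c).
  by apply: IH => j /rr; [exact: bB|exact: tB].
move=> e e0.
have [cs Hcs] := totally_bounded_and (bB _ (mem_head _ _)) bA (tB _ (mem_head _ _)) tA e0.
exists cs => c; have [c' c's [Bi Br]] := Hcs c; exists c' => // j.
by rewrite inE => /orP[/eqP ->|]; [|exact: Br].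
Qed.

Lemma totally_bounded_le (R : realType) (U : zmodType) (B C : R -> U -> Prop) (K : R) :
  0 < K -> (forall e c, 0 < e -> B e c -> C (K * e) c) ->
  totally_bounded B -> totally_bounded C.
Proof.
move=> K0 BC tB e e0; have eK : 0 < e / K by rewrite divr_gt0.
have [cs H] := tB _ eK; exists cs => c; have [c' c's Bc] := H c.
by exists c' => //; have := BC _ _ eK Bc; rewrite mulrC divfK // gt_eqF.
Qed.

Definition shift_ball (R : realType) (U : zmodType) (g : U -> R) (e : R) (c : U) :=
  forall x, `|g (x + c) - g x| <= e.

(** Bochner's form of almost periodicity: total boundedness of the translates in the sup norm, with
    the net expressed through displacements. *)
Definition almost_periodic (R : realType) (U : zmodType) (g : U -> R) :=
  totally_bounded (shift_ball g).

Lemma balls_shift (R : realType) (U : zmodType) (g : U -> R) : balls (shift_ball g).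
Proof.
split=> [e e0 x|e c H x|a b c d Hc Hd x].
- by rewrite addr0 subrr normr0.
- by have := H (x - c); rewrite subrK distrC.
- have -> : g (x + (c + d)) - g x = (g (x + c + d) - g (x + c)) + (g (x + c) - g x).
    by rewrite addrA; ring.
  by rewrite (le_trans (ler_normD _ _)) // (addrC a) lerD.
Qed.

Lemma almost_periodic_bounded (R : realType) (U : zmodType) (g : U -> R) :
  almost_periodic g -> exists2 M, 0 < M & forall x, `|g x| <= M.
Proof.
move=> /(_ 1 ltr01)[cs H].
exists (1 + \sum_(c <- cs) `|g c|); first by rewrite ltr_pwDl // sumr_ge0.
move=> x; have [c cs_c /(_ c)] := H x; rewrite (addrC c) subrK => h.
rewrite -[g x](subrK (g c)) (le_trans (ler_normD _ _)) // lerD //.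
by rewrite (big_rem c) //= lerDl sumr_ge0.
Qed.

Lemma almost_periodicM (R : realType) (U : zmodType) (f g : U -> R) :
  almost_periodic f -> almost_periodic g -> almost_periodic (fun x => f x * g x).
Proof.
move=> af ag; have [M M0 fM] := almost_periodic_bounded af.
have [N N0 gN] := almost_periodic_bounded ag.
apply: (totally_bounded_le (addr_gt0 M0 N0) _ (totally_bounded_and
  (balls_shift f) (balls_shift g) af ag)) => e c e0 [Bf Bg] x.
have -> : f (x + c) * g (x + c) - f x * g x =
  f (x + c) * (g (x + c) - g x) + (f (x + c) - f x) * g x by ring.
rewrite (le_trans (ler_normD _ _)) // !normrM mulrDl (mulrC N) lerD //.
- by apply: ler_pM.
- by apply: ler_pM.
Qed.

Definition avg (R : realType) (U : zmodType) (F : seq U) (g : U -> R) (x : U) : R :=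
  (\sum_(c <- F) g (x + c)) / (size F)%:R.

Lemma avg_avg (R : realType) (U : zmodType) (F G : seq U) (g : U -> R) x :
  avg F (avg G g) x = avg [seq c + d | c <- F, d <- G] g x.
Proof.
rewrite /avg size_allpairs natrM invfM big_allpairs_dep.
rewrite -mulr_suml -mulrA; congr (_ * _); last exact: mulrC.
by apply: eq_bigr => c _; apply: eq_bigr => d _; rewrite addrA.
Qed.

Lemma avgC (R : realType) (U : zmodType) (F G : seq U) (g : U -> R) x :
  avg F (avg G g) x = avg G (avg F g) x.
Proof.
rewrite /avg -!mulr_suml exchange_big /= mulrAC; congr (_ / _ / _).
by apply: eq_bigr => c _; apply: eq_bigr => d _; rewrite addrAC.
Qed.

Lemma avg_le (R : realType) (U : zmodType) (F : seq U) (g : U -> R) x u :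
  F != [::] -> (forall c, c \in F -> g (x + c) <= u) -> avg F g x <= u.
Proof.
move=> F0 H; rewrite /avg ler_pdivrMr; last by rewrite ltr0n lt0n size_eq0.
have -> : u * (size F)%:R = \sum_(c <- F) u.
  by rewrite big_const_seq count_predT iter_addr_0 mulr_natr.
by rewrite big_seq [leRHS]big_seq; apply: ler_sum.
Qed.

Lemma avgN (R : realType) (U : zmodType) (F : seq U) (g : U -> R) x :
  avg F (fun y => - g y) x = - avg F g x.
Proof. by rewrite /avg sumrN mulNr. Qed.

Lemma avgB (R : realType) (U : zmodType) (F : seq U) (f g : U -> R) x :
  avg F (fun y => f y - g y) x = avg F f x - avg F g x.
Proof. by rewrite /avg sumrB mulrBl. Qed.

Lemma avg_near (R : realType) (U : zmodType) (F : seq U) (g : U -> R) x a e :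
  F != [::] -> (forall y, `|g y - a| <= e) -> `|avg F g x - a| <= e.
Proof.
move=> F0 H; have up : avg F g x <= a + e.
  by apply: avg_le => // c _; have := H (x + c); rewrite ler_distl => /andP[].
have lo : avg F (fun y => - g y) x <= - (a - e).
  apply: avg_le => // c _; have := H (x + c); rewrite ler_distl => /andP[h _].
  by rewrite lerN2.
by rewrite ler_distl up andbT -lerN2 -avgN.
Qed.

Lemma shift_ball_avg (R : realType) (U : zmodType) (F : seq U) (g : U -> R) e c :
  F != [::] -> shift_ball g e c -> shift_ball (avg F g) e c.
Proof.
move=> F0 H x.
have -> : avg F g (x + c) - avg F g x = avg F (fun y => g (y + c) - g y) x.
  by rewrite avgB; congr (_ - _); rewrite /avg; congr (_ / _);
     apply: eq_bigr => d _; rewrite addrAC.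
by rewrite -[avg F _ x]subr0; apply: avg_near => // y; rewrite subr0.
Qed.

(** An infimum of uniform upper bounds makes sense on any abelian group, without measure or growing
    boxes; that some average is nearly constant at this value is [mean_approx]. *)
Definition mean (R : realType) (U : zmodType) (g : U -> R) : R :=
  inf [set u | exists F, F != [::] /\ forall x, avg F g x <= u].

(* If the average [h] over [F] nearly attains the infimum of the upper bounds but
   dips below it at [y0], averaging [h] once more over the points [y0 - c], for
   [c] in a net, lowers the upper bound beyond the infimum. *)
Lemma mean_approx (R : realType) (U : zmodType) (g : U -> R) :
  almost_periodic g -> forall e : R, 0 < e ->
  exists F, F != [::] /\ forall x, `|avg F g x - mean g| <= e.
Proof.
move=> ag e e0; pose d := e / 3; have d0 : 0 < d by rewrite divr_gt0.
have ed : e = 3 * d by rewrite /d; field.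
have [M M0 gM] := almost_periodic_bounded ag.
have [cs Hcs] := ag _ d0.
have k0 : (0 < size cs)%N by have [c] := Hcs 0; case: (cs).
pose k : R := (size cs)%:R; have kR : 0 < k by rewrite ltr0n.
pose E := [set u : R | exists F : seq U, F != [::] /\ forall x, avg F g x <= u].
have hE : has_inf E.
  split; first by exists M, [:: 0]; split=> // x; apply: avg_le => // c _;
    rewrite (le_trans (ler_norm _)).
  exists (- M) => u [F [F0 Hu]]; apply: le_trans (Hu 0).
  rewrite -lerN2 -avgN opprK; apply: avg_le => // c _.
  by rewrite (le_trans (ler_norm _)) // normrN.
pose m := mean g; have mE : m = inf E by [].
(* Among the [k] averaged points one lies at least [2 d] below the infimum; this must outweigh an
   excess [eta] at the others and a gain of [eta] for each of the [k] points, hence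
   [eta * k = d]. *)
pose eta := d / k; have eta0 : 0 < eta by rewrite divr_gt0.
have ek : eta * k = d by rewrite divfK // gt_eqF.
have etad : eta <= d by rewrite ler_pdivrMr // ler_peMr ?(ltW d0) // ler1n.
have [u [F [F0 Hu]] um] := inf_adherent eta0 hE; rewrite -mE in um.
exists F; split=> // x; rewrite ler_distl; apply/andP; split; last first.
  by have := Hu x; lra.
rewrite leNgt; apply/negP => hx.
pose h := avg F g.
pose F' := [seq x - c | c <- cs].
have F'0 : F' != [::] by rewrite -size_eq0 size_map -lt0n.
have : E (m - eta).
  exists [seq a + b | a <- F', b <- F]; split.
    by rewrite -size_eq0 size_allpairs muln_eq0 !size_eq0 negb_or F'0.
  move=> y; rewrite -avg_avg -/h /avg size_map ler_pdivrMr // -/k.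
  have [c' c's Bc'] := Hcs y.
  have hc : h (y + (x - c')) <= m - 2 * d.
    have := shift_ball_avg F0 Bc' x; rewrite -/h addrCA.
    by rewrite ler_distl => /andP[_]; rewrite /h; lra.
  rewrite big_map (big_rem c') //=.
  have : \sum_(c <- rem c' cs) h (y + (x - c)) <= (m + eta) * (k - 1).
    have -> : (m + eta) * (k - 1) = \sum_(c <- rem c' cs) (m + eta).
      rewrite big_const_seq count_predT iter_addr_0 size_rem // -mulr_natr.
      by congr (_ * _); rewrite /k -[in LHS](prednK k0) -natr1 addrK.
    apply: ler_sum => c _; apply: (le_trans (Hu _)); exact: ltW.
  nra.
move=> /(ge_inf hE.2); rewrite -mE; lra.
Qed.

(** Averages commute, and averaging a function that is within [e] of a constant keeps it so;
    composing the averages therefore serves all functions at once. *)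
Lemma mean_approx_seq (R : realType) (U : zmodType) (gs : seq (U -> R)) :
  (forall g, g \in gs -> almost_periodic g) -> forall e : R, 0 < e ->
  exists F, F != [::] /\ forall g, g \in gs -> forall x, `|avg F g x - mean g| <= e.
Proof.
move=> ag e e0; elim: gs ag => [|g gs IH] ag; first by exists [:: 0].
have [|F [F0 HF]] := IH; first by move=> h hs; apply: ag; rewrite inE hs orbT.
have [G [G0 HG]] := mean_approx (ag g (mem_head _ _)) e0.
exists [seq a + b | a <- F, b <- G]; split.
  by rewrite -size_eq0 size_allpairs muln_eq0 !size_eq0 negb_or F0.
move=> h; rewrite inE => /orP[/eqP ->|hs] x; rewrite -avg_avg.
- by apply: avg_near.
- by rewrite avgC; apply: avg_near => // y; exact: HF.
Qed.

(** * Partial derivatives and difference quotients *)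

Definition Ck (R : realType) (n k : nat) (f : 'rV[R]_n -> R) :=
  (forall s : seq 'I_n, (size s <= k)%N -> continuous (dl s f)) /\
  (forall s : seq 'I_n, (size s < k)%N ->
     forall i x, derivable (dl s f) x (ebas R i)).

Lemma continuous_lin (R : realType) (T : topologicalType) (a : R) (f g : T -> R) :
  continuous f -> continuous g -> continuous (fun x => a * f x + g x).
Proof.
move=> cf cg x; apply: cvgD; last exact: cg.
by apply: cvgM; [exact: cvg_cst|exact: cf].
Qed.

Lemma continuous_addr (R : realType) (W : normedModType R) (c : W) :
  continuous (fun x : W => x + c).
Proof. by move=> x; apply: cvgD; [exact: cvg_id|exact: cvg_cst]. Qed.

Section Smoothness.
Variables (R : realType) (n : nat).
Local Notation V := 'rV[R]_n.
Implicit Types (f g u v : V -> R) (s : seq 'I_n) (x y c w : V).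

Lemma Ckb_Ck k f : Ckb k f -> Ck k f.
Proof. by case=> ? []. Qed.

Lemma quotient_transl f c x w :
  (fun h : R => h^-1 *: ((transl f c \o shift x) (h *: w) - transl f c x)) =
  (fun h : R => h^-1 *: ((f \o shift (x + c)) (h *: w) - f (x + c))).
Proof. by apply/funext => h /=; rewrite /transl addrA. Qed.

Lemma derive_transl f c x w : derive (transl f c) x w = derive f (x + c) w.
Proof. by rewrite /derive quotient_transl. Qed.

Lemma derivable_transl f c x w :
  derivable f (x + c) w -> derivable (transl f c) x w.
Proof. by rewrite /derivable quotient_transl. Qed.

Lemma dl_transl s f c : dl s (transl f c) = transl (dl s f) c.
Proof.
elim: s => //= i s ->; apply/funext => x.
by rewrite /pd derive_transl.
Qed.

Lemma Ck_transl k f c : Ck k f -> Ck k (transl f c).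
Proof.
move=> [cf df]; split=> s sk; rewrite dl_transl.
  move=> x; apply: (@continuous_comp _ _ _ (fun y : V => y + c) (dl s f)).
    exact: continuous_addr.
  exact: cf.
by move=> i x; apply: derivable_transl; exact: df.
Qed.

Lemma linE (a : R) f g : (fun x => a * f x + g x) = (a *: f) + g.
Proof. by apply/funext. Qed.

Lemma dl_lin k s (a : R) f g : Ck k f -> Ck k g -> (size s <= k)%N ->
  dl s (fun x => a * f x + g x) = (fun x => a * dl s f x + dl s g x).
Proof.
move=> [_ df] [_ dg]; elim: s => //= i s IH sk; rewrite IH; last exact: ltnW.
apply/funext => x; rewrite /pd linE deriveD; last exact: dg.
  by rewrite deriveZ //; exact: df.
by apply: derivableZ; exact: df.
Qed.

Lemma Ck_lin k (a : R) f g : Ck k f -> Ck k g -> Ck k (fun x => a * f x + g x).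
Proof.
move=> Cf Cg; split=> s sk; rewrite (dl_lin _ Cf Cg) ?(ltnW sk) //.
  by apply: continuous_lin; [exact: Cf.1|exact: Cg.1].
move=> x y; rewrite linE; apply: derivableD; last exact: Cg.2.
by apply: derivableZ; exact: Cf.2.
Qed.

Lemma dl_cst s (a : R) : dl s (fun=> a : R) = (fun _ : V => if s is [::] then a else 0).
Proof.
elim: s => // i s IH; rewrite /= IH; apply/funext => x.
by case: s {IH} => [|j s]; rewrite /pd derive_cst.
Qed.

Lemma Ck_cst k (a : R) : Ck k (fun _ : V => a).
Proof.
split=> s _; rewrite dl_cst; first exact: cst_continuous.
by move=> x y; exact: derivable_cst.
Qed.

Lemma scaleE (a : R) f : (fun x => a * f x) = (fun x => a * f x + 0).
Proof. by apply/funext => x; rewrite addr0. Qed.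

Lemma Ck_scale k (a : R) f : Ck k f -> Ck k (fun x => a * f x).
Proof. by move=> Cf; rewrite scaleE; apply: Ck_lin => //; exact: Ck_cst. Qed.

Lemma addE f g : (fun x => f x + g x) = (fun x => 1 * f x + g x).
Proof. by apply/funext => x; rewrite mul1r. Qed.

Lemma Ck_add k f g : Ck k f -> Ck k g -> Ck k (fun x => f x + g x).
Proof. by rewrite addE; exact: Ck_lin. Qed.

Lemma fsubE f g : fsub f g = (fun x => - 1 * g x + f x).
Proof. by apply/funext => x; rewrite /fsub mulN1r addrC. Qed.

Lemma Ck_fsub k f g : Ck k f -> Ck k g -> Ck k (fsub f g).
Proof. by move=> Cf Cg; rewrite fsubE; exact: Ck_lin. Qed.

Lemma dl_fsub k s f g : Ck k f -> Ck k g -> (size s <= k)%N ->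
  dl s (fsub f g) = fsub (dl s f) (dl s g).
Proof. by move=> Cf Cg sk; rewrite fsubE (dl_lin _ Cg Cf) // -fsubE. Qed.

Lemma dl_cat s t f : dl (s ++ t) f = dl s (dl t f).
Proof. by rewrite /dl foldr_cat. Qed.

Lemma Ck_dl k l s f : (size s + l <= k)%N -> Ck k f -> Ck l (dl s f).
Proof.
move=> sl [cf df]; split=> t tl; rewrite -dl_cat; [apply: cf|apply: df];
  by rewrite size_cat addnC; apply: leq_trans sl; rewrite ?leq_add2l // ltn_add2l.
Qed.

Lemma is_derive_line f i x (t : R) : derivable f (x + t *: ebas R i) (ebas R i) ->
  is_derive t 1 (fun t : R => f (x + t *: ebas R i)) (pd i f (x + t *: ebas R i)).
Proof.
move=> df.
have E : (fun h : R => h^-1 *: (((fun t : R => f (x + t *: ebas R i)) \o shift t)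
    (h *: 1) - f (x + t *: ebas R i))) = (fun h : R => h^-1 *:
    ((f \o shift (x + t *: ebas R i)) (h *: ebas R i) - f (x + t *: ebas R i))).
  apply/funext => h /=; congr (_ *: (f _ - _)).
  by rewrite -[h%:A]/(h * 1) mulr1 scalerDl addrCA.
apply: DeriveDef; first by rewrite /derivable E.
by rewrite /pd /derive E.
Qed.

Lemma pd_mvt f i x (h : R) : (forall y, derivable f y (ebas R i)) -> 0 < h ->
  exists2 t, 0 <= t <= h &
    f (x + h *: ebas R i) - f x = h * pd i f (x + t *: ebas R i).
Proof.
move=> df h0.
have dline (t : R) := is_derive_line (df (x + t *: ebas R i)).
have [|t] := @MVT_segment R (fun t => f (x + t *: ebas R i)) _ 0 h (ltW h0)
   (fun t _ => dline t).
  apply: derivable_within_continuous => t _.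
  by case: (dline t).
rewrite in_itv /= scale0r addr0 subr0 mulrC => th E; exists t => //.
Qed.

Lemma pd_lipschitz f i x (A t : R) : (forall y, derivable f y (ebas R i)) ->
  (forall y, `|pd i f y| <= A) -> `|f (x + t *: ebas R i) - f x| <= A * `|t|.
Proof.
move=> df Hf.
have pos (y : V) (h : R) : 0 < h -> `|f (y + h *: ebas R i) - f y| <= A * h.
  move=> h0; have [s _ ->] := pd_mvt y df h0.
  by rewrite normrM gtr0_norm // mulrC ler_pM2r.
case: (ltrgtP t 0) => [t0|t0|->]; last by rewrite scale0r addr0 subrr !normr0 mulr0.
  rewrite (ltr0_norm t0) distrC.
  have := pos (x + t *: ebas R i) (- t); rewrite oppr_gt0 scaleNr addrK.
  exact.
by rewrite (gtr0_norm t0); exact: pos.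
Qed.

(** Walking from [y] to [x] one coordinate at a time uses partial derivatives only, which is why the
    induction is over a list of axes. *)
Lemma grad_lipschitz f x y (A : R) : (forall i z, derivable f z (ebas R i)) ->
  (forall i z, `|pd i f z| <= A) ->
  `|f x - f y| <= A * \sum_(i < n) `|(x - y) 0 i|.
Proof.
move=> df Hf.
have H (r : seq 'I_n) : `|f (y + \sum_(i <- r) (x - y) 0 i *: ebas R i) - f y| <=
    A * \sum_(i <- r) `|(x - y) 0 i|.
  elim: r => [|i r IH]; first by rewrite !big_nil addr0 subrr normr0 mulr0.
  rewrite !big_cons mulrDr [_ *: _ + _]addrC addrA.
  set z := y + _.
  rewrite (_ : f _ - f y = (f (z + (x - y) 0 i *: ebas R i) - f z) + (f z - f y)).
    by rewrite (le_trans (ler_normD _ _)) // lerD // pd_lipschitz.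
  by rewrite addrA; ring.
by have := H (index_enum _); rewrite -row_sum_ebas (addrC y) subrK.
Qed.

Definition fd (h : R) s u : V -> R :=
  foldr (fun i g x => g (x + h *: ebas R i) - g x) u s.

Lemma fd_fsub h s f g : fd h s (fsub f g) = fsub (fd h s f) (fd h s g).
Proof.
elim: s => //= i s ->; apply/funext => x; rewrite /fsub; ring.
Qed.

Lemma fd_transl h s f c : fd h s (transl f c) = transl (fd h s f) c.
Proof.
by elim: s => //= i s ->; apply/funext => x; rewrite /transl addrAC.
Qed.

Lemma fd_cons h i s u : fd h (i :: s) u = fsub (transl (fd h s u) (h *: ebas R i)) (fd h s u).
Proof. by []. Qed.

Lemma fd_consr h i s u : fd h (i :: s) u = fd h s (fsub (transl u (h *: ebas R i)) u).
Proof. by rewrite fd_fsub fd_transl. Qed.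

Lemma fd_cat h s t u : fd h (s ++ t) u = fd h s (fd h t u).
Proof. by rewrite /fd foldr_cat. Qed.

Lemma fd_comm h s t u : fd h s (fd h t u) = fd h t (fd h s u).
Proof.
elim: s u => // i s IH u.
by rewrite (fd_consr h i s u) -IH fd_fsub fd_transl -fd_consr.
Qed.

Lemma fd_perm h s t u : perm_eq s t -> fd h s u = fd h t u.
Proof.
move=> st; apply: (@catCA_perm_subst _ _ (fun t => fd h t u)) st => s1 s2 s3.
by rewrite !fd_cat fd_comm.
Qed.

Lemma fd_bound h s u (eta : R) : (forall x, `|u x| <= eta) ->
  forall x, `|fd h s u x| <= 2 ^+ size s * eta.
Proof.
move=> Hu; elim: s => [|i s IH] x; first by rewrite /= expr0 mul1r.
rewrite fd_cons /fsub /transl (le_trans (ler_normB _ _)) //= exprS.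
by have := IH x; have := IH (x + h *: ebas R i); lra.
Qed.

(** The difference along [i] is moved innermost, so that the induction hypothesis applies to the
    displacement of [u]; the mean value theorem for [dl s u] then puts [pd i] outermost, as [dl]
    requires. Symmetry of derivatives is not presupposed, so it can be deduced from this. *)
Lemma fd_mvt k h s u x : Ck k u -> (size s <= k)%N -> 0 < h ->
  exists2 y, `|y - x| <= (size s)%:R * h * \sum_(i < n) `|ebas R i| &
    fd h s u x = h ^+ size s * dl s u y.
Proof.
move=> Cu sk h0; elim: s sk u Cu => [|i s IH] sk u Cu.
  by exists x; rewrite ?subrr ?normr0 ?mul0r // expr0 mul1r.
have Cw : Ck k (fsub (transl u (h *: ebas R i)) u).
  by apply: Ck_fsub => //; exact: Ck_transl.
have [y yx E] := IH (ltnW sk) _ Cw.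
rewrite fd_consr E (dl_fsub (Ck_transl _ Cu) Cu (ltnW sk)) dl_transl.
have [t /andP[t0 th]] := pd_mvt y (Cu.2 s sk i) h0.
rewrite /fsub /transl => ->; exists (y + t *: ebas R i); last by rewrite exprSr mulrA.
rewrite addrAC (le_trans (ler_normD _ _)) //= -natr1 mulrDl mulrDl mul1r lerD //.
rewrite normrZ ger0_norm //; apply: ler_pM => //.
by rewrite (bigD1 i) //= lerDl sumr_ge0.
Qed.

Lemma fd_dl_limit k s u x (e : R) : Ck k u -> (size s <= k)%N -> 0 < e ->
  exists2 d : R, 0 < d & forall h : R, 0 < h < d ->
    `|fd h s u x / h ^+ size s - dl s u x| <= e.
Proof.
move=> Cu sk e0; have := Cu.1 s sk x => /cvgrPdist_lt/(_ _ e0).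
rewrite -nbhs_nearE => /nbhs_ballP[r /= r0 Hr].
pose K : R := (size s)%:R * \sum_(i < n) `|ebas R i| + 1.
have K0 : 0 < K by rewrite ltr_pwDr // mulr_ge0 // sumr_ge0.
exists (r / K); first by rewrite divr_gt0.
move=> h /andP[h0 hr]; have [y yx ->] := fd_mvt x Cu sk h0.
rewrite mulrAC divff ?mul1r; last by rewrite expf_neq0 // gt_eqF.
rewrite distrC; apply/ltW/Hr; rewrite -ball_normE /= distrC (le_lt_trans yx) //.
move: hr; rewrite ltr_pdivlMr // => hr; apply: le_lt_trans hr.
by rewrite mulrAC mulrC ler_pM2l // lerDl.
Qed.

(* Iterated difference quotients do not depend on the order of the directions. *)
Lemma dl_perm k s t u : Ck k u -> (size s <= k)%N -> perm_eq s t -> dl s u = dl t u.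
Proof.
move=> Cu sk st; apply/funext => x; apply/eqP; rewrite -subr_eq0 -normr_eq0.
rewrite eq_le normr_ge0 andbT; apply/ler_addgt0Pr => e e0; rewrite add0r.
have e2 : 0 < e / 2 by rewrite divr_gt0.
have tk : (size t <= k)%N by rewrite -(perm_size st).
have [d d0 Hd] := fd_dl_limit x Cu sk e2.
have [d' d0' Hd'] := fd_dl_limit x Cu tk e2.
pose h := Num.min d d' / 2.
have m0 : 0 < Num.min d d' by rewrite lt_min d0.
have hd : 0 < h < d.
  by rewrite divr_gt0 //= ltr_pdivrMr //; have : Num.min d d' <= d; [rewrite ge_min lexx|lra].
have hd' : 0 < h < d'.
  by rewrite divr_gt0 //= ltr_pdivrMr //;
    have : Num.min d d' <= d'; [rewrite ge_min lexx orbT|lra].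
have := Hd _ hd; have := Hd' _ hd'; rewrite (fd_perm h u st) (perm_size st).
set q := _ / _ => h1 h2.
rewrite (_ : dl s u x - dl t u x = (q - dl t u x) - (q - dl s u x)); last by ring.
by rewrite (le_trans (ler_normB _ _)) // (splitr e) lerD.
Qed.

(* Again through difference quotients, whose bounds survive a uniform limit. *)
Lemma dl_bound_limit k s v (A : R) : Ck k v -> (size s <= k)%N ->
  (forall eta : R, 0 < eta -> exists u, [/\ Ck k u, forall x, `|dl s u x| <= A &
     forall x, `|u x - v x| <= eta]) ->
  forall x, `|dl s v x| <= A.
Proof.
move=> Cv sk H x; apply/ler_addgt0Pr => e e0.
have e2 : 0 < e / 2 by rewrite divr_gt0.
have [d d0 Hd] := fd_dl_limit x Cv sk e2.
pose h := d / 2; have h0 : 0 < h by rewrite divr_gt0.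
have hd : 0 < h < d by rewrite h0 ltr_pdivrMr //; lra.
have hs : 0 < h ^+ size s by rewrite exprn_gt0.
(* The step [h] is fixed first: a difference quotient magnifies a uniform error by at most
   [2 ^+ size s / h ^+ size s], which [eta] compensates down to [e / 2]. *)
pose eta := h ^+ size s * (e / 2) / 2 ^+ size s.
have eta0 : 0 < eta by rewrite divr_gt0 ?mulr_gt0 // exprn_gt0.
have [u [Cu uA uv]] := H _ eta0.
have [y _ Ey] := fd_mvt x Cu sk h0.
have := fd_bound h s uv x; rewrite -/(fsub u v) fd_fsub /fsub Ey => h1.
have h2 : `|fd h s v x / h ^+ size s - dl s u y| <= e / 2.
  have -> : fd h s v x / h ^+ size s - dl s u y =
      - ((h ^+ size s * dl s u y - fd h s v x) / h ^+ size s).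
    by field; rewrite gt_eqF.
  rewrite normrN normrM normfV (gtr0_norm hs) ler_pdivrMr //.
  by apply: (le_trans h1); rewrite /eta mulrCA divff ?mulr1 ?(mulrC (e / 2)) // expf_neq0.
have h3 := Hd _ hd; have h4 := uA y.
move: h2 h3; rewrite !ler_distl => /andP[a1 a2] /andP[a3 a4].
move: h4; rewrite !ler_norml => /andP[b1 b2]; apply/andP; split; lra.
Qed.

Definition mcount s : 'I_n -> nat := fun i => count_mem i s.
Definition mseq (b : 'I_n -> nat) : seq 'I_n :=
  flatten [seq nseq (b i) i | i <- enum 'I_n].

Lemma size_mseq b : size (mseq b) = mlen b.
Proof.
rewrite /mseq size_flatten /shape -map_comp sumnE big_map big_enum.
by apply: eq_bigr => i _ /=; rewrite size_nseq.
Qed.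

Lemma perm_mseq s : perm_eq s (mseq (mcount s)).
Proof.
apply/allP => x _ /=; apply/eqP; rewrite /mseq count_flatten -map_comp sumnE big_map.
rewrite big_enum /= (bigD1 x) //= big1 ?addn0; first by rewrite count_nseq /= eqxx mul1n.
by move=> i ix; rewrite count_nseq /= (negPf ix).
Qed.

Lemma mlen_mcount s : mlen (mcount s) = size s.
Proof. by rewrite -size_mseq (perm_size (perm_mseq s)). Qed.

(** The bridge between the multi-indices of the definitions and the lists used in inductions: by
    symmetry a list matters only through its multiplicities. *)
Lemma dl_dpart k s f : Ck k f -> (size s <= k)%N -> dl s f = dpart (mcount s) f.
Proof. by move=> Cf sk; exact: dl_perm Cf sk (perm_mseq s). Qed.

End Smoothness.

(** * Hoelder bounds *)

Section HolderBounds.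
Variables (R : realType) (n : nat).
Local Notation V := 'rV[R]_n.
Implicit Types (f g u : V -> R) (s : seq 'I_n) (x y z c d : V) (m A B e : R).

Lemma enorm_ge0 z : 0 <= enorm z.
Proof. exact: sqrtr_ge0. Qed.

Lemma coord_le_enorm z i : `|z 0 i| <= enorm z.
Proof.
rewrite -sqrtr_sqr ler_wsqrtr // /dotp (bigD1 i) //= expr2 lerDl sumr_ge0 // => j _.
by rewrite -expr2 sqr_ge0.
Qed.

Lemma enorm_gt0 z : z != 0 -> 0 < enorm z.
Proof.
move=> /eqP z0; rewrite lt_neqAle enorm_ge0 andbT eq_sym; apply/eqP => ez.
apply: z0; apply/rowP => i; rewrite mxE; apply/eqP; rewrite -normr_le0 -ez.
exact: coord_le_enorm.
Qed.

(** At distance at most 1 the gradient bound gives [n A E] with [E <= powR E gam]; beyond 1 the sup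
    bound gives [2 A] with [1 <= powR E gam]. The factor is the sum of both constants. *)
Lemma holder_interp f A (gam : R) : (forall i z, derivable f z (ebas R i)) ->
  (forall z, `|f z| <= A) -> (forall i z, `|pd i f z| <= A) -> 0 <= gam <= 1 ->
  forall x y, `|f x - f y| <= (n%:R + 2) * A * powR (enorm (x - y)) gam.
Proof.
move=> df fA pA /andP[gam0 gam1] x y.
have A0 : 0 <= A by apply: le_trans (fA 0).
case: (eqVneq x y) => [->|xy].
  by rewrite subrr normr0 !mulr_ge0 ?powR_ge0 // addr_ge0.
pose E := enorm (x - y); have E0 : 0 < E by rewrite enorm_gt0 // subr_eq0.
have [E1|E1] := leP E 1.
  have h1 : `|f x - f y| <= A * (n%:R * E).
    apply: (le_trans (grad_lipschitz x y df pA)); rewrite ler_wpM2l //.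
    apply: (@le_trans _ _ (\sum_(i < n) E)).
      by apply: ler_sum => i _; exact: coord_le_enorm.
    by rewrite sumr_const card_ord mulr_natl.
  have h2 : E <= powR E gam.
    by rewrite -[leLHS]powRr1 ?(ltW E0) //; apply: ger_powR => //; rewrite E0.
  have n0 : (0 : R) <= n%:R by [].
  apply: (le_trans h1).
  rewrite mulrA (mulrC A) ler_pM ?mulr_ge0 ?(ltW E0) // ler_wpM2r // lerDl //.
have h2 : 1 <= powR E gam.
  by rewrite -[leLHS](powRr0 E); apply: ler_powR => //; exact: ltW.
have h1 : `|f x - f y| <= 2 * A.
  by rewrite (le_trans (ler_normB _ _)) //; have := fA x; have := fA y; lra.
apply: (le_trans h1); rewrite -[leLHS]mulr1 ler_pM ?mulr_ge0 //.
by rewrite ler_wpM2r // lerDr.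
Qed.

(* Sup and Hoelder bounds share the constant [A]: this is a ball of the max norm, which
   is equivalent to [hnorm], the sum of the two. *)
Definition hb m A f :=
  (forall s, (size s <= ipart m)%N -> forall x, `|dl s f x| <= A) /\
  (fpart m != 0 -> forall s, size s = ipart m -> forall x y,
     `|dl s f x - dl s f y| <= A * powR (enorm (x - y)) (fpart m)).

Lemma hb_ge0 m A f : hb m A f -> 0 <= A.
Proof. by move=> [H _]; exact: le_trans (H [::] isT 0). Qed.

Lemma hb_le m A B f : A <= B -> hb m A f -> hb m B f.
Proof.
move=> AB [H1 H2]; split=> [s sk x|g0 s sk x y]; first exact: le_trans (H1 s sk x) AB.
by apply: le_trans (H2 g0 s sk x y) _; rewrite ler_wpM2r ?powR_ge0.
Qed.

Lemma hb_lin m A B (a : R) f g : Ck (ipart m) f -> Ck (ipart m) g ->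
  hb m A f -> hb m B g -> hb m (`|a| * A + B) (fun x => a * f x + g x).
Proof.
move=> Cf Cg [f1 f2] [g1 g2]; split=> [s sk x|g0 s sk x y].
  rewrite (dl_lin _ Cf Cg sk) (le_trans (ler_normD _ _)) // normrM lerD //.
    by rewrite ler_wpM2l // f1.
  exact: g1.
have sk' : (size s <= ipart m)%N by rewrite sk.
rewrite (dl_lin _ Cf Cg sk').
rewrite (_ : _ - _ = a * (dl s f x - dl s f y) + (dl s g x - dl s g y)); last by ring.
rewrite (le_trans (ler_normD _ _)) // normrM mulrDl -mulrA lerD //.
  by rewrite ler_wpM2l // f2.
exact: g2.
Qed.

Lemma hb_cst0 m : hb m 0 (fun _ : V => 0).
Proof.
split=> [s _ x|_ s _ x y]; rewrite dl_cst; first by case: s; rewrite normr0.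
by rewrite subrr normr0 mul0r.
Qed.

Lemma hb_scale m A (a : R) f : Ck (ipart m) f -> hb m A f ->
  hb m (`|a| * A) (fun x => a * f x).
Proof.
move=> Cf Hf; rewrite scaleE -[_ * A]addr0; apply: hb_lin => //; first exact: Ck_cst.
exact: hb_cst0.
Qed.

Lemma hb_add m A B f g : Ck (ipart m) f -> Ck (ipart m) g ->
  hb m A f -> hb m B g -> hb m (A + B) (fun x => f x + g x).
Proof.
move=> Cf Cg Hf Hg; rewrite addE; have := hb_lin 1 Cf Cg Hf Hg.
by rewrite normr1 mul1r.
Qed.

Lemma hb_fsub m A B f g : Ck (ipart m) f -> Ck (ipart m) g ->
  hb m A f -> hb m B g -> hb m (A + B) (fsub f g).
Proof.
move=> Cf Cg Hf Hg; rewrite fsubE; have := hb_lin (- 1) Cg Cf Hg Hf.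
by rewrite normrN normr1 mul1r addrC.
Qed.

Lemma hb_transl m A f c : hb m A f -> hb m A (transl f c).
Proof.
move=> [H1 H2]; split=> [s sk x|g0 s sk x y]; rewrite dl_transl /transl; first exact: H1.
have := H2 g0 s sk (x + c) (y + c).
by rewrite (_ : x + c - (y + c) = x - y) // opprD addrACA subrr addr0.
Qed.

Lemma CmbP m f : Cmb m f <-> Ck (ipart m) f /\ exists A, hb m A f.
Proof.
split=> [[Cf Hf]|[[cf df] [A [H1 H2]]]].
  have Ckf := Ckb_Ck Cf; split=> //; case: Cf => _ [_ [M HM]].
  have M0 : 0 <= M by apply: le_trans (HM [::] isT 0).
  case: Hf => [g0|[N HN]].
    by exists M; split=> [//|]; rewrite g0 eqxx.
  (* The shared constant must dominate both bounds, and [N] comes without a sign. *)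
  exists (M + `|N|); split=> [s sk x|g0 s sk x y].
    by apply: le_trans (HM s sk x) _; rewrite lerDl.
  case: (eqVneq x y) => [->|xy].
    by rewrite subrr normr0 mulr_ge0 ?powR_ge0 // addr_ge0.
  rewrite (dl_dpart Ckf); last by rewrite sk.
  apply: le_trans (HN _ _ _ _ xy) _; first by rewrite mlen_mcount.
  by rewrite ler_wpM2r ?powR_ge0 // (le_trans (ler_norm _)) // lerDr.
split; first by split=> //; split=> //; exists A.
case: (eqVneq (fpart m) 0) => [|g0]; [by left|right].
by exists A => b bk x y _; apply: H2 => //; rewrite size_mseq.
Qed.

Lemma hb_hnorm m f : Cmb m f -> hb m (hnorm m f) f.
Proof.
move=> /CmbP[Cf [A [H1 H2]]].
have A0 : 0 <= A by exact: (@hb_ge0 m A f).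
pose S1 := [set r | exists b x, (mlen b <= ipart m)%N /\ r = `|dpart b f x|].
have ub1 : has_ubound S1.
  by exists A => _ [b [x [bk ->]]]; apply: H1; rewrite size_mseq.
have sup1 s x : (size s <= ipart m)%N -> `|dl s f x| <= supnorm (ipart m) f.
  move=> sk; rewrite (dl_dpart Cf sk); apply: (ub_le_sup ub1).
  by exists (mcount s), x; rewrite mlen_mcount.
have sup0 : 0 <= supnorm (ipart m) f by apply: le_trans (sup1 [::] 0 isT).
case: (eqVneq (fpart m) 0) => [g0|g0].
  split=> [s sk x|]; last by rewrite g0 eqxx.
  by rewrite /hnorm g0 eqxx addr0 sup1.
pose S2 := [set r | exists b x y, mlen b = ipart m /\ x != y /\
     r = `|dpart b f x - dpart b f y| / powR (enorm (x - y)) (fpart m)].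
have ub2 : has_ubound S2.
  exists A => _ [b [x [y [bk [xy ->]]]]].
  rewrite ler_pdivrMr; last by rewrite powR_gt0 // enorm_gt0 // subr_eq0.
  by apply: H2 => //; rewrite size_mseq.
have S2E : hsemi (ipart m) (fpart m) f = sup S2 by [].
have semi0 : 0 <= hsemi (ipart m) (fpart m) f.
  (* For [n = 0] no two points differ, and the [sup] of the empty set is 0. *)
  rewrite S2E; have [ne|ne] := pselect (S2 !=set0); last first.
    by rewrite sup_out // => -[].
  case: ne => r Sr; apply: le_trans (ub_le_sup ub2 Sr).
  by case: Sr => b [x [y [_ [_ ->]]]]; rewrite divr_ge0 ?powR_ge0.
rewrite /hnorm (negPf g0); split=> [s sk x|_ s sk x y].
  by apply: le_trans (sup1 s x sk) _; rewrite lerDl.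
case: (eqVneq x y) => [->|xy].
  by rewrite subrr normr0 mulr_ge0 ?powR_ge0 // addr_ge0.
rewrite (dl_dpart Cf); last by rewrite sk.
rewrite -ler_pdivrMr; last by rewrite powR_gt0 // enorm_gt0 // subr_eq0.
apply: le_trans (_ : hsemi (ipart m) (fpart m) f <= _); last by rewrite lerDr.
by rewrite S2E; apply: (ub_le_sup ub2); exists (mcount s), x, y; rewrite mlen_mcount.
Qed.

Lemma hnorm_le m A f : hb m A f -> hnorm m f <= 2 * A.
Proof.
move=> Hf; have A0 := hb_ge0 Hf; case: Hf => H1 H2.
have h1 : supnorm (ipart m) f <= A.
  apply: ge_sup; first by exists `|dpart (fun=> 0%N) f 0|, (fun=> 0%N), 0; rewrite /mlen big1.
  by move=> _ [b [x [bk ->]]]; apply: H1; rewrite size_mseq.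
rewrite /hnorm; case: eqVneq => g0; first by lra.
suff : hsemi (ipart m) (fpart m) f <= A by lra.
rewrite /hsemi; set S := mkset _.
have [ne|ne] := pselect (S !=set0); last by rewrite sup_out // => -[].
apply: ge_sup => // _ [b [x [y [bk [xy ->]]]]].
rewrite ler_pdivrMr; last by rewrite powR_gt0 // enorm_gt0 // subr_eq0.
by apply: H2 => //; rewrite size_mseq.
Qed.

Lemma fpart_itv m : 0 <= m -> 0 <= fpart m < 1.
Proof.
move=> m0; rewrite /fpart /ipart subr_ge0 truncn_le m0 /=.
by rewrite ltrBlDr addrC natr1 truncnS_gt.
Qed.

Lemma ipart_fpart m : 0 <= m -> ipart (fpart m) = 0%N.
Proof.
by move=> m0; have := fpart_itv m0; rewrite /ipart => g; apply/truncn_def; rewrite mulr0n.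
Qed.

Lemma fpart_fpart m : 0 <= m -> fpart (fpart m) = fpart m.
Proof. by move=> m0; rewrite {1}/fpart ipart_fpart // subr0. Qed.

Lemma leq_ipart m k : 0 <= m -> (k%:R <= m) = (k <= ipart m)%N.
Proof. by move=> m0; rewrite /ipart truncn_ge_nat. Qed.

(** One derivative beyond the integer part replaces the Hoelder estimate, by interpolation; this is
    how smooth functions enter non-integer classes. *)
Lemma hb_of_sup m A f : 0 <= m -> Ck (ipart m).+1 f ->
  (forall s, (size s <= (ipart m).+1)%N -> forall x, `|dl s f x| <= A) ->
  hb m ((n%:R + 2) * A) f.
Proof.
move=> m0 Cf H; have A0 : 0 <= A by apply: le_trans (H [::] isT 0).
split=> [s sk x|_ s sk x y].
  apply: (le_trans (H _ (leqW sk) x)); rewrite ler_peMl //.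
  by rewrite -[leLHS]add0r lerD // ler1n.
apply: holder_interp.
- by apply: Cf.2; rewrite sk.
- by apply: H; rewrite sk.
- by move=> i z; apply: (H (i :: s)); rewrite /= sk.
- by have /andP[-> /ltW] := fpart_itv m0.
Qed.

Lemma Cmb_lin m (a : R) f g : Cmb m f -> Cmb m g -> Cmb m (fun x => a * f x + g x).
Proof.
move=> /CmbP[Cf [A Hf]] /CmbP[Cg [B Hg]]; apply/CmbP; split; first exact: Ck_lin.
by eexists; exact: hb_lin Cf Cg Hf Hg.
Qed.

Lemma Cmb_transl m f c : Cmb m f -> Cmb m (transl f c).
Proof.
move=> /CmbP[Cf [A Hf]]; apply/CmbP; split; first exact: Ck_transl.
by exists A; exact: hb_transl.
Qed.

Lemma Cmb_fsub m f g : Cmb m f -> Cmb m g -> Cmb m (fsub f g).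
Proof. by move=> Cf Cg; rewrite fsubE; exact: Cmb_lin. Qed.

End HolderBounds.

(** * Precompact translates *)

Section AlmostPeriodicHolder.
Variables (R : realType) (n : nat).
Local Notation V := 'rV[R]_n.
Implicit Types (f g u : V -> R) (s : seq 'I_n) (x y z c d : V) (m A B e : R).

Definition hball m f e c := hb m e (fsub (transl f c) f).

Lemma balls_hball m f : Ck (ipart m) f -> balls (hball m f).
Proof.
move=> Cf.
have Cd c : Ck (ipart m) (fsub (transl f c) f) by apply: Ck_fsub => //; exact: Ck_transl.
split; rewrite /hball.
- move=> e e0; apply: (hb_le e0); have -> : fsub (transl f 0) f = (fun=> 0).
    by apply/funext => x; rewrite /fsub /transl addr0 subrr.
  exact: hb_cst0.
- move=> e c Hc; have -> : fsub (transl f (- c)) f =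
      (fun x => - 1 * transl (fsub (transl f c) f) (- c) x).
    by apply/funext => x; rewrite /fsub /transl subrK; ring.
  have := hb_scale (- 1) (Ck_transl (- c) (Cd c)) (hb_transl (- c) Hc).
  by rewrite normrN normr1 mul1r.
- move=> a b c d Hc Hd; have -> : fsub (transl f (c + d)) f =
      (fun x => transl (fsub (transl f c) f) d x + fsub (transl f d) f x).
    by apply/funext => x; rewrite /fsub /transl (addrC c d) (addrA x); ring.
  exact: hb_add (Ck_transl d (Cd c)) (Cd d) (hb_transl d Hc) Hd.
Qed.

Lemma hball_transl m f e c d :
  hb m e (fsub (transl f c) (transl f d)) <-> hball m f e (c - d).
Proof.
rewrite /hball; split=> [/(hb_transl (- d))|/(hb_transl d)]; congr hb; apply/funext => x.
  by rewrite /fsub /transl subrK -addrA (addrC (- d)).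
by rewrite /fsub /transl -addrA (addrC d) subrK.
Qed.

(** Precompactness comes with arbitrary centres. Choosing one translate in each ball doubles the
    radius, and translation invariance then turns closeness of two translates into a small
    displacement by [c - c']. *)
Lemma CapP m f : Cap m f <-> Cmb m f /\ totally_bounded (hball m f).
Proof.
split=> [[Cf pf]|[Cf tf]]; have [Ckf _] := (CmbP m f).1 Cf;
  (split; [exact: Cf|move=> e e0]).
  have e2 : 0 < e / 2 by rewrite divr_gt0.
  have [gs [Cg Hg]] := pf _ e2.
  pose good g := [set c | hb m (e / 2) (fsub (transl f c) g)].
  exists [seq xget 0 (good g) | g <- gs] => c.
  have hb2 g c' : g \in gs -> hnorm m (fsub (transl f c') g) < e / 2 ->
      hb m (e / 2) (fsub (transl f c') g).
    move=> gg h; apply: (hb_le (ltW h)); apply: hb_hnorm; apply: Cmb_fsub.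
      exact: Cmb_transl.
    exact: Cg.
  have [g gg /(hb2 _ _ gg) hc] := Hg c; exists (xget 0 (good g)); first exact: map_f.
  have hr : good g (xget 0 (good g)) by apply: xgetPex; exists c.
  apply/hball_transl.
  have [Ckg _] := (CmbP m g).1 (Cg g gg).
  have Cd d : Ck (ipart m) (fsub (transl f d) g) by apply: Ck_fsub => //; exact: Ck_transl.
  have := hb_fsub (Cd _) (Cd _) hc hr; rewrite -splitr; congr hb.
  by apply/funext => x; rewrite /fsub; ring.
have e4 : 0 < e / 4 by rewrite divr_gt0.
have [cs Hcs] := tf _ e4; exists [seq transl f c | c <- cs]; split.
  by move=> _ /mapP[c _ ->]; exact: Cmb_transl.
move=> c; have [c' c's /hball_transl/hnorm_le h] := Hcs c.
by exists (transl f c'); [exact: map_f|apply: (le_lt_trans h); lra].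
Qed.

Lemma hball_shift_ball m f e c : Ck (ipart m) f -> hball m f e c -> shift_ball f e c.
Proof. by move=> Cf [H _] x; exact: (H [::]). Qed.

Lemma Cap_almost_periodic m f : Cap m f -> almost_periodic f.
Proof.
move=> /CapP[/CmbP[Cf _] tf] e /tf[cs H]; exists cs => c; have [c' c's Hc] := H c.
by exists c' => //; exact: hball_shift_ball Hc.
Qed.

Lemma Cap_lin m (a : R) f g : Cap m f -> Cap m g -> Cap m (fun x => a * f x + g x).
Proof.
move=> /CapP[Cf tf] /CapP[Cg tg]; apply/CapP; split; first exact: Cmb_lin.
have [Ckf _] := (CmbP m f).1 Cf; have [Ckg _] := (CmbP m g).1 Cg.
have a0 : 0 < `|a| + 1 by rewrite ltr_pwDr.
apply: (totally_bounded_le a0 _ (totally_bounded_and (balls_hball Ckf)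
  (balls_hball Ckg) tf tg)) => e c e0 [Hf Hg].
rewrite mulrDl mul1r /hball.
have -> : fsub (transl (fun x => a * f x + g x) c) (fun x => a * f x + g x) =
    (fun x => a * fsub (transl f c) f x + fsub (transl g c) g x).
  by apply/funext => x; rewrite /fsub /transl; ring.
exact: hb_lin (Ck_fsub (Ck_transl c Ckf) Ckf) (Ck_fsub (Ck_transl c Ckg) Ckg) Hf Hg.
Qed.

Lemma Cap_limit m f : Cmb m f ->
  (forall e, 0 < e -> exists2 u, Cap m u & hb m e (fsub u f)) -> Cap m f.
Proof.
move=> Cf H; apply/CapP; split=> // e e0; have e3 : 0 < e / 3 by rewrite divr_gt0.
have [Ckf _] := (CmbP m f).1 Cf.
have [u /CapP[Cu tu] uf] := H _ e3; have [Cku _] := (CmbP m u).1 Cu.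
have [cs Hcs] := tu _ e3; exists cs => c; have [c' c's Hc] := Hcs c; exists c' => //.
have Cuf : Ck (ipart m) (fsub u f) by exact: Ck_fsub.
have -> : e = e / 3 + (e / 3 + e / 3) by field.
move: Hc; rewrite /hball; set d := c - c' => Hc.
have -> : fsub (transl f d) f =
    (fun x => fsub (transl u d) u x + fsub (fsub u f) (transl (fsub u f) d) x).
  by apply/funext => x; rewrite /fsub /transl; ring.
have Cufd := Ck_transl d Cuf.
exact: hb_add (Ck_fsub (Ck_transl d Cku) Cku) (Ck_fsub Cuf Cufd) Hc
  (hb_fsub Cuf Cufd uf (hb_transl d uf)).
Qed.

Lemma continuous_le_limit (F : V -> R) x (a A : R) : continuous F ->
  (forall r : R, 0 < r -> exists2 d : V, `|d| < r & `|F (x - d) - a| <= A) ->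
  `|F x - a| <= A.
Proof.
move=> cF H; apply/ler_addgt0Pr => e e0.
have /cvgrPdist_lt/(_ _ e0) := cF x.
rewrite -nbhs_nearE => /nbhs_ballP[r /= r0 Hr].
have [d dr Hd] := H _ r0.
have hd : ball x r (x - d) by rewrite -ball_normE /= opprB addrC subrK.
have := Hr _ hd => /= h.
rewrite (_ : F x - a = (F (x - d) - a) + (F x - F (x - d))); last by ring.
by rewrite (le_trans (ler_normD _ _)) // lerD // ltW.
Qed.

Lemma hball_closed m f e c : Ck (ipart m) f ->
  (forall r : R, 0 < r -> exists2 d : V, `|d| < r & hball m f e (c - d)) ->
  hball m f e c.
Proof.
move=> Cf H.
have dE s c' : (size s <= ipart m)%N ->
    dl s (fsub (transl f c') f) = fsub (transl (dl s f) c') (dl s f).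
  by move=> sk; rewrite (dl_fsub (Ck_transl _ Cf) Cf sk) dl_transl.
split=> [s sk x|g0 s sk x y].
  rewrite dE // /fsub /transl; apply: continuous_le_limit; first exact: Cf.1.
  move=> r /H[d dr [Hd _]]; exists d => //.
  by have := Hd s sk x; rewrite dE // /fsub /transl addrA.
have sk' : (size s <= ipart m)%N by rewrite sk.
rewrite dE // /fsub /transl.
(* Both shifted values become part of one continuous function at the single point [x + c], so the
   limit argument of the sup bound applies to the Hoelder quotient too. *)
pose F z := - 1 * transl (dl s f) (y - x) z + dl s f z.
have cF : continuous F.
  apply: continuous_lin; last exact: Cf.1.
  by rewrite -dl_transl; apply: (Ck_transl _ Cf).1.
have yx z : z + (y - x) = y + (z - x) by rewrite addrCA.
rewrite (_ : _ - _ = F (x + c) - (dl s f x - dl s f y)); last first.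
  by rewrite /F /transl yx (addrC x c) addrK; ring.
apply: continuous_le_limit => // r /H[d dr [_ Hd]]; exists d => //.
have := Hd g0 s sk x y; rewrite dE // /fsub /transl; congr (`|_| <= _).
rewrite /F /transl.
rewrite (_ : x + c - d + (y - x) = y + (c - d)) ?(addrA x c); last first.
  by rewrite addrCA -(addrA x) addrAC subrr add0r.
by ring.
Qed.

(* A class of the net which has translations arbitrarily close to 0 has its centre
   close to [f], because balls are closed under pointwise limits of derivatives. *)
Lemma hball_cont0 m f : Cap m f -> forall e, 0 < e ->
  exists2 r : R, 0 < r & forall c : V, `|c| < r -> hball m f e c.
Proof.
move=> /CapP[/CmbP[Cf _] tf] e e0; have e2 : 0 < e / 2 by rewrite divr_gt0.
have bB := balls_hball Cf.
have [cs Hcs] := tf _ e2.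
pose near_ (c' : V) (r : R) := exists2 c : V, `|c| < r & hball m f (e / 2) (c - c').
(* As the net is finite, one [r] is so small that any class meeting the ball of radius [r] meets
   every smaller ball. *)
have [r r0 Hr] : exists2 r : R, 0 < r & forall c', c' \in cs -> near_ c' r ->
    forall r' : R, 0 < r' -> near_ c' r'.
  elim: cs {Hcs} => [|c' cs [r r0 IH]]; first by exists 1.
  have [H|/existsNP[r' /not_implyP[r'0 H]]] := pselect (forall r' : R, 0 < r' -> near_ c' r').
    exists r => // d; rewrite inE => /orP[/eqP -> //|dcs]; exact: IH.
  exists (Num.min r r'); first by rewrite lt_min r0.
  move=> d; rewrite inE => /orP[/eqP -> [c]|dcs [c]]; rewrite lt_min => /andP[c1 c2] Hc.
    by case: H; exists c.
  by apply: IH => //; exists c.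
exists r => // c cr; have [c' c's Hc] := Hcs c.
apply: hball_closed => // r' r'0.
have [|d dr Hd] := Hr c' c's _ r' r'0; first by exists c.
exists d => //; have := ballsB bB Hc Hd.
by rewrite -splitr opprB addrA subrK.
Qed.

End AlmostPeriodicHolder.

(** * Trigonometric polynomials *)

Section TrigonometricPolynomials.
Variables (R : realType) (n : nat).
Local Notation V := 'rV[R]_n.
Implicit Types (f g : V -> R) (l x c : V) (p q : trigpoly R n) (m : R).

Lemma dotpD l l' x : dotp (l + l') x = dotp l x + dotp l' x.
Proof. by rewrite -big_split; apply: eq_bigr => i _; rewrite mxE mulrDl. Qed.

Lemma dotpNl l x : dotp (- l) x = - dotp l x.
Proof. by rewrite /dotp -sumrN; apply: eq_bigr => i _; rewrite mxE mulNr. Qed.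

Lemma dotp0l x : dotp 0 x = 0 :> R.
Proof. by rewrite /dotp big1 // => i _; rewrite mxE mul0r. Qed.

Lemma dotpDr l x c : dotp l (x + c) = dotp l x + dotp l c.
Proof. by rewrite -big_split; apply: eq_bigr => i _; rewrite mxE mulrDr. Qed.

Lemma dotpBr l x c : dotp l (x - c) = dotp l x - dotp l c.
Proof. by rewrite -sumrB; apply: eq_bigr => i _; rewrite !mxE mulrBr. Qed.

Definition trig g := exists p, (forall x, tp_re p x = g x) /\ forall x, tp_im p x = 0.

Lemma eq_trig f g : f =1 g -> trig f -> trig g.
Proof. by move=> /funext ->. Qed.

Lemma trigD f g : trig f -> trig g -> trig (fun x => f x + g x).
Proof.
move=> [p [pf p0]] [q [qg q0]]; exists (p ++ q).
split=> x; rewrite /tp_re /tp_im big_cat /=.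
  by rewrite -pf -qg.
by have := p0 x; have := q0 x; rewrite /tp_im => -> ->; rewrite addr0.
Qed.

Lemma trigZ (a : R) f : trig f -> trig (fun x => a * f x).
Proof.
move=> [p [pf p0]]; exists [seq ((a * t.1.1, a * t.1.2), t.2) | t <- p].
split=> x.
  rewrite -pf /tp_re big_map big_distrr; apply: eq_bigr => t _ /=; ring.
transitivity (a * tp_im p x); last by rewrite p0 mulr0.
rewrite /tp_im big_map big_distrr.
by apply: eq_bigr => t _ /=; ring.
Qed.

Lemma trigM f g : trig f -> trig g -> trig (fun x => f x * g x).
Proof.
move=> [p [pf p0]] [q [qg q0]].
pose mul (t u : (R * R) * V) : (R * R) * V :=
  ((t.1.1 * u.1.1 - t.1.2 * u.1.2, t.1.1 * u.1.2 + t.1.2 * u.1.1), t.2 + u.2).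
exists [seq mul t u | t <- p, u <- q]; split=> x.
  transitivity (tp_re p x * tp_re q x - tp_im p x * tp_im q x).
    rewrite /tp_re /tp_im big_allpairs_dep !big_distrlr -sumrB; apply: eq_bigr => t _.
    by rewrite -sumrB; apply: eq_bigr => u _; rewrite /= dotpD cosD sinD; ring.
  by rewrite p0 mul0r subr0 pf qg.
transitivity (tp_re p x * tp_im q x + tp_im p x * tp_re q x).
  rewrite /tp_re /tp_im big_allpairs_dep !big_distrlr -big_split; apply: eq_bigr => t _.
  by rewrite -big_split; apply: eq_bigr => u _; rewrite /= dotpD cosD sinD; ring.
by rewrite p0 q0 mulr0 mul0r addr0.
Qed.

Lemma trig_cos l : trig (fun x => cos (dotp l x)).
Proof.
exists [:: ((1 / 2, 0), l); ((1 / 2, 0), - l)]; split=> x;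
  rewrite /tp_re /tp_im !big_cons big_nil /= dotpNl cosN sinN; by field.
Qed.

Lemma trig_sin l : trig (fun x => sin (dotp l x)).
Proof.
exists [:: ((0, - (1 / 2)), l); ((0, 1 / 2), - l)]; split=> x;
  rewrite /tp_re /tp_im !big_cons big_nil /= dotpNl cosN sinN; by field.
Qed.

Lemma trig_cst (a : R) : trig (fun=> a).
Proof.
apply: eq_trig (trigZ a (trig_cos 0)) => x.
by rewrite dotp0l cos0 mulr1.
Qed.

Lemma trig_sum (I : Type) (r : seq I) (F : I -> V -> R) :
  (forall i, trig (F i)) -> trig (fun x => \sum_(i <- r) F i x).
Proof.
move=> HF; elim: r => [|i r IH].
  by apply: eq_trig (trig_cst 0) => x; rewrite big_nil.
by apply: eq_trig (trigD (HF i) IH) => x; rewrite big_cons.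
Qed.

Lemma trigX f k : trig f -> trig (fun x => f x ^+ k).
Proof.
move=> tf; elim: k => [|k IH]; first by apply: eq_trig (trig_cst 1) => x; rewrite expr0.
by apply: eq_trig (trigM tf IH) => x; rewrite exprS.
Qed.

(** The phase makes the family stable under differentiation up to a factor, each derivative adding
    [pi / 2], and under translation; it also covers the sine. *)
Definition wave l (phi : R) x : R := cos (dotp l x + phi).

Lemma is_derive_cos_affine (a b : R) :
  is_derive (0 : R) 1 (fun h : R => cos (h * a + b)) (a * cos (b + pi / 2)).
Proof.
have d1 : is_derive (0 : R) 1 (fun h : R => h * a + b) a.
  have -> : (fun h : R => h * a + b) = (a *: id) + cst b.
    by apply/funext => h; rewrite /= mulrC.
  by apply: is_derive_eq; rewrite addr0 -[_ *: _]/(a * 1) mulr1.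
have d2 := is_derive_cos (0 * a + b).
have := @is_derive1_comp R cos (fun h => h * a + b) 0 _ _ d2 d1.
by rewrite mul0r add0r -cosDpihalf mulrC.
Qed.

Lemma is_derive_wave l phi i x :
  is_derive x (ebas R i) (wave l phi) (l 0 i * wave l (phi + pi / 2) x).
Proof.
pose b := dotp l x + phi.
have E : (fun h : R => wave l phi (h *: ebas R i + x)) = (fun h => cos (h * l 0 i + b)).
  apply/funext => h; rewrite /wave dotpDr /b addrA; congr (cos (_ + _ + _)).
  rewrite /dotp (bigD1 i) //= big1 ?addr0; first by rewrite !mxE !eqxx mulr1 mulrC.
  by move=> j ji; rewrite !mxE (negPf ji) andbF !mulr0.
have [d1 d2] := is_derive_cos_affine (l 0 i) b.
have Q : (fun h : R => h^-1 *: (((fun h => cos (h * l 0 i + b)) \o shift 0) (h *: 1)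
     - cos (0 * l 0 i + b))) =
   (fun h : R => h^-1 *: ((wave l phi \o shift x) (h *: ebas R i) - wave l phi x)).
  apply/funext => h /=; rewrite -[h%:A]/(h * 1) mulr1 addr0; congr (_ *: (_ - _)).
    by move/(congr1 (@^~ h)): E => /= ->.
  by rewrite mul0r add0r.
apply: DeriveDef; first by move: d1; rewrite /derivable Q.
by move: d2; rewrite /derive Q => ->; rewrite /wave /b addrA.
Qed.

Lemma dl_wave l phi s :
  dl s (wave l phi) =
  (fun x => (\prod_(i <- s) l 0 i) * wave l (phi + (pi / 2) *+ size s) x).
Proof.
elim: s => [|i s IH] /=.
  by apply/funext => x; rewrite big_nil mul1r mulr0n addr0.
rewrite IH; apply/funext => x; rewrite /pd.
have [d1 d2] := is_derive_wave l (phi + (pi / 2) *+ size s) i x.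
rewrite (_ : (fun x => _) = (\prod_(i <- s) l 0 i) *: wave l (phi + (pi / 2) *+ size s)) //.
rewrite deriveZ // d2 big_cons (mulrSr (pi / 2)) -[_ *: _]/(_ * _) addrA mulrA.
by rewrite (mulrC (l 0 i)).
Qed.

Lemma continuous_dotp l : continuous (fun x => dotp l x).
Proof.
rewrite /dotp; elim: (index_enum _) => [|i r IH].
  by rewrite (_ : (fun x => _) = fun=> 0);
    [exact: cst_continuous|apply/funext => x; rewrite big_nil].
rewrite (_ : (fun x => _) = fun x => l 0 i * x 0 i + \sum_(i <- r) l 0 i * x 0 i);
  last by apply/funext => x; rewrite big_cons.
by apply: continuous_lin => //; exact: coord_continuous.
Qed.

Lemma continuous_wave l phi : continuous (wave l phi).
Proof.
move=> x; apply: (@continuous_comp _ _ _ (fun x => dotp l x + phi) cos).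
  by apply: (@continuous_comp _ _ _ (dotp l) (+%R^~ phi)); [exact: continuous_dotp|
    exact: continuous_addr].
exact: continuous_cos.
Qed.

Lemma Ck_wave k l phi : Ck k (wave l phi).
Proof.
split=> s _; rewrite dl_wave.
  by rewrite scaleE; apply: continuous_lin; [exact: continuous_wave|exact: cst_continuous].
move=> i x; rewrite (_ : (fun x => _) =
  (\prod_(i <- s) l 0 i) *: wave l (phi + (pi / 2) *+ size s)) //.
by apply: derivableZ; case: (is_derive_wave l (phi + (pi / 2) *+ size s) i x).
Qed.

Lemma wave_coef_bound l (k : nat) s : (size s <= k)%N ->
  `|\prod_(i <- s) l 0 i| <= (1 + \sum_i `|l 0 i|) ^+ k.
Proof.
move=> sk; set L := 1 + _.
have L1 : 1 <= L by rewrite lerDl sumr_ge0.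
apply: (@le_trans _ _ (L ^+ size s)); last exact: ler_weXn2l.
elim: s {sk} => [|i s IH]; first by rewrite big_nil normr1.
rewrite big_cons normrM /= exprS ler_pM //.
by rewrite /L (bigD1 i) //= addrCA lerDl addr_ge0 // sumr_ge0.
Qed.

(** Distance to [2 pi Z]: total boundedness is compactness of the circle, to be pulled back along
    [dotp l]. *)
Definition circle_ball (e t : R) := exists z : int, `|t - pi *+ 2 * z%:~R| <= e.

Lemma balls_circle : balls circle_ball.
Proof.
split=> [e e0|e t [z h]|a b s t [z hs] [w ht]].
- by exists 0; rewrite mulr0 subr0 normr0.
- by exists (- z); rewrite intrN mulrN -opprD normrN.
- exists (z + w); rewrite intrD mulrDr opprD addrACA.
  by rewrite (le_trans (ler_normD _ _)) // lerD.
Qed.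

Lemma totally_bounded_circle : totally_bounded circle_ball.
Proof.
move=> e e0; have P0 : 0 < (pi *+ 2 : R).
  by have := @pi_gt0 R; move: (pi : R) => p; lra.
rewrite /circle_ball; move: (pi *+ 2 : R) P0 => P P0.
exists [seq j%:R * e | j <- iota 0 (Num.truncn (P / e)).+1] => t.
pose z := Num.floor (t / P); pose r := t - P * z%:~R.
have r0 : 0 <= r.
  have := @floor_le R (t / P); rewrite -/z ler_pdivlMr // mulrC /r; lra.
have rP : r <= P.
  have := @floorD1_gt R (t / P); rewrite -/z intrD mulr1z ltr_pdivrMr // /r; lra.
have re : 0 <= r / e by rewrite divr_ge0 // ltW.
have j1 : (Num.truncn (r / e))%:R <= r / e by rewrite truncn_le.
have j2 : r / e < (Num.truncn (r / e)).+1%:R by exact: truncnS_gt.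
exists ((Num.truncn (r / e))%:R * e).
  apply/mapP; exists (Num.truncn (r / e)) => //; rewrite mem_iota add0n ltnS.
  by apply: le_truncn; rewrite ler_pM2r ?invr_gt0.
exists z; rewrite addrAC -/r.
move: (Num.truncn (r / e)) j1 j2 => j.
rewrite ler_pdivlMr // ltr_pdivrMr // -natr1 mulrDl mul1r => j1 j2.
by rewrite ler_norml; apply/andP; split; lra.
Qed.

Lemma wave_diff_bound l phi c (k : nat) (e : R) : circle_ball e (dotp l c) ->
  forall s, (size s <= k)%N -> forall x,
  `|dl s (fsub (transl (wave l phi) c) (wave l phi)) x| <=
  (1 + \sum_i `|l 0 i|) ^+ k * e.
Proof.
move=> [z Hz] s sk x; have Cw := Ck_wave k l phi.
rewrite (dl_fsub (Ck_transl c Cw) Cw sk) dl_transl dl_wave /fsub /transl.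
rewrite -mulrBr normrM ler_pM //; first exact: wave_coef_bound.
apply: le_trans Hz; rewrite /wave dotpDr; set b := phi + _.
rewrite -[X in `|X - _|](cosDint _ (- z)).
apply: le_trans (cos_lipschitz _ _) _; rewrite intrN mulrN.
rewrite (_ : _ - (dotp l x + b) = dotp l c - pi *+ 2 * z%:~R) //.
by move: (pi *+ 2) => P; ring.
Qed.

(** A translate of a wave is a phase shift, so all its derivatives move by an amount controlled by
    [dotp l c] modulo [2 pi]. *)
Lemma Cap_wave m l phi : 0 <= m -> Cap m (wave l phi).
Proof.
move=> m0; pose k := (ipart m).+1; pose L := (1 + \sum_i `|l 0 i|) ^+ k.
have L0 : 0 < L by rewrite exprn_gt0 // ltr_pwDl // sumr_ge0.
have K0 : 0 < (n%:R + 2) * L by rewrite mulr_gt0 // ltr_wpDl.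
apply/CapP; split.
  apply/CmbP; split; first exact: Ck_wave.
  exists ((n%:R + 2) * L); apply: hb_of_sup => //; first exact: Ck_wave.
  move=> s sk x; rewrite dl_wave normrM -[leRHS]mulr1 ler_pM ?cos_max //.
  exact: wave_coef_bound.
apply: (totally_bounded_le K0 _ (totally_bounded_preim (dotpBr l) balls_circle
  totally_bounded_circle)) => e c e0 Hc.
rewrite -mulrA; apply: hb_of_sup => //.
  by apply: Ck_fsub; [apply: Ck_transl|]; exact: Ck_wave.
exact: wave_diff_bound.
Qed.

Lemma Cap_cst0 m : 0 <= m -> Cap m (fun _ : V => 0).
Proof.
move=> m0; have := Cap_lin (- 1) (Cap_wave 0 0 m0) (Cap_wave 0 0 m0).
by congr Cap; apply/funext => x; rewrite mulN1r addNr.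
Qed.

Lemma Cap_tp_re m p : 0 <= m -> Cap m (tp_re p).
Proof.
move=> m0; elim: p => [|[[a b] l] p IH].
  rewrite (_ : tp_re [::] = fun=> 0); first exact: Cap_cst0.
  by apply/funext => x; rewrite /tp_re big_nil.
have := Cap_lin a (Cap_wave l 0 m0) (Cap_lin (- b) (Cap_wave l (- (pi / 2)) m0) IH).
congr Cap; apply/funext => x.
by rewrite /tp_re big_cons /wave /= addr0 cosBpihalf addrA mulNr.
Qed.

Lemma Cap_trig m f : 0 <= m -> trig f -> Cap m f.
Proof. by move=> m0 [p [/funext <- _]]; exact: Cap_tp_re. Qed.

Lemma Cinfb_tp_re p : Cinfb (tp_re p).
Proof.
move=> k; have [] := (Cap_tp_re p (ler0n R k)).1.
by rewrite /ipart natrK.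
Qed.

End TrigonometricPolynomials.

(** * Approximation by trigonometric polynomials *)

(** Commuting the averages over [F] and [cs] compares the lower bound [a] with an average of nearly
    constant functions. *)
Lemma mean_ge (R : realType) (U : zmodType) (g : U -> R) (cs : seq U) (a : R) :
  almost_periodic g -> cs != [::] -> (forall x, a <= avg cs g x) -> a <= mean g.
Proof.
move=> ag cs0 H; apply/ler_addgt0Pr => e e0.
have [F [F0 HF]] := mean_approx ag e0.
have h1 : avg F (fun x => - avg cs g x) 0 <= - a.
  by apply: avg_le => // c _; rewrite lerN2.
have h2 : avg cs (avg F g) 0 <= mean g + e.
  by apply: avg_le => // c _; have := HF (0 + c); rewrite ler_distl => /andP[].
by move: h1; rewrite avgN lerN2 avgC => /le_trans; apply.
Qed.

Section Approximation.
Variables (R : realType) (n : nat).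
Local Notation V := 'rV[R]_n.
Implicit Types (f g u v : V -> R) (x y c l : V) (m A e : R).

Lemma almost_periodic_trig g : trig g -> almost_periodic g.
Proof. by move=> /(Cap_trig (lexx 0)) /Cap_almost_periodic. Qed.

(* A power of [sum_l (1 + cos (l . c))] concentrates near its maximum, and the
   set where it is close to the maximum is relatively dense. *)
Lemma bohr_kernel (Lam : seq V) (kap eps : R) : kap < 1 -> 0 < eps ->
  exists K, [/\ trig K, forall c, 0 <= K c, 1 <= mean K &
    forall c, (exists2 l, l \in Lam & cos (dotp l c) <= kap) -> K c <= eps].
Proof.
move=> kap1 eps0; pose k' := Num.max kap 0.
have k'0 : 0 <= k' by rewrite le_max lexx orbT.
have k'1 : k' < 1 by rewrite gt_max kap1 ltr01.
pose r : R := (size Lam)%:R + 1; have r1 : 1 <= r by rewrite lerDr.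
(* The constant 2 keeps [Q] positive even where every cosine is -1 or [Lam] is empty. *)
pose Q c : R := 2 + \sum_(l <- Lam) (1 + cos (dotp l c)).
have term0 l c : 0 <= 1 + cos (dotp l c) by have := cos_geN1 (dotp l c); lra.
have Q0 c : 0 < Q c by rewrite ltr_pwDl // sumr_ge0.
have Q00 : Q 0 = 2 * r.
  rewrite /Q (eq_bigr (fun=> 2)); last first.
    by move=> l _; rewrite -(subrr 0) dotpBr subrr cos0.
  by rewrite big_const_seq count_predT iter_addr_0 -mulr_natl /r; ring.
have Qbad c : (exists2 l, l \in Lam & cos (dotp l c) <= kap) -> Q c <= 2 * r - (1 - k').
  move=> [l lL lk]; have lk' : cos (dotp l c) <= k' by rewrite le_max lk.
  rewrite /Q (big_rem l) //=.
  have : \sum_(i <- rem l Lam) (1 + cos (dotp i c)) <= 2 * ((size Lam)%:R - 1).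
    have -> : 2 * ((size Lam)%:R - 1) = \sum_(i <- rem l Lam) (2 : R).
      rewrite big_const_seq count_predT iter_addr_0 size_rem // -(mulr_natr 2).
      have s0 : (0 < size Lam)%N by case: (Lam) lL.
      by congr (_ * _); rewrite -[in LHS](prednK s0) -natr1 addrK.
    by apply: ler_sum => i _; have := cos_le1 (dotp i c); lra.
  rewrite /r; lra.
have tQ : trig Q.
  apply: trigD; first exact: trig_cst.
  by apply: trig_sum => l; apply: trigD; [exact: trig_cst|exact: trig_cos].
(* [q1] bounds [Q] on the bad points; [q2] is halfway from there to the maximum [Q 0 = 2 r], and
   from every point some translation in the net reaches it. *)
pose q1 := 2 * r - (1 - k'); pose q2 := 2 * r - (1 - k') / 2.
have q20 : 0 < q2 by rewrite /q2; lra.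
have q10 : 0 < q1 by rewrite /q1; lra.
have d0 : 0 < (1 - k') / 2 by lra.
have [cs Hcs] := almost_periodic_trig tQ d0.
have cs0 : cs != [::] by have [c] := Hcs 0; case: (cs).
pose k : R := (size cs)%:R.
have k0 : 0 < k by rewrite ltr0n lt0n size_eq0.
have dense x : exists2 c, c \in cs & q2 <= Q (x + c).
  have [c cc Hc] := Hcs (- x); exists c => //.
  have := Hc (x + c); rewrite [x + c + _]addrC -(opprD x c) addNr Q00.
  by rewrite ler_distl /q2 => /andP[_]; lra.
have [N HN] : exists N, (q1 / q2) ^+ N < eps / k.
  have q12 : `|q1 / q2| < 1.
    by rewrite ger0_norm ?divr_ge0 ?(ltW q10) ?(ltW q20) // ltr_pdivrMr // mul1r /q1 /q2; lra.
  have /cvgrPdist_lt/(_ (eps / k)) := cvg_expr q12.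
  rewrite divr_gt0 // => /(_ isT)[N _ /(_ N (leqnn N))] /=.
  by rewrite sub0r normrN => h; exists N; apply: le_lt_trans (ler_norm _) h.
have qN : 0 < q2 ^+ N by rewrite exprn_gt0.
(* Scaled so that one of the [k] translates always has value at least [k], whence averages over [cs]
   are at least 1, while bad points have [K c <= k * (q1 / q2) ^+ N < eps]. *)
pose K c := k / q2 ^+ N * Q c ^+ N.
have tK : trig K by apply: trigZ; exact: trigX.
have K0 c : 0 <= K c by rewrite mulr_ge0 ?divr_ge0 ?exprn_ge0 ?ltW.
exists K; split=> //.
  apply: (@mean_ge _ _ _ cs) => //; first exact: almost_periodic_trig.
  move=> x; have [c cc Hc] := dense x.
  rewrite /avg ler_pdivlMr // mul1r -/k (big_rem c) //=.
  have kK : k <= K (x + c).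
    by rewrite /K mulrAC ler_pdivlMr // ler_pM2l // lerXn2r // nnegrE ltW.
  by apply: (le_trans kK); rewrite lerDl sumr_ge0.
move=> c /Qbad Qc; rewrite /K.
have : Q c ^+ N <= q1 ^+ N by rewrite lerXn2r // nnegrE ltW.
move=> h; apply: (@le_trans _ _ (k * (q1 / q2) ^+ N)).
  by rewrite expr_div_n mulrA mulrAC ler_pM2r ?invr_gt0 // ler_pM2l.
by move: HN; rewrite ltr_pdivlMr // mulrC => /ltW.
Qed.

(* Expanding [K] into exponentials, [avg_c (K c * f (x + c))] is a combination of the
   [cos (l . x)], [sin (l . x)] with averages of [f * cos], [f * sin] as coefficients. *)
Lemma twisted_mean K f : trig K -> almost_periodic f ->
  exists2 p, trig p & forall e, 0 < e -> exists F, [/\ F != [::],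
    `|(\sum_(c <- F) K c) / (size F)%:R - mean K| <= e &
    forall x, `|(\sum_(c <- F) K c * f (x + c)) / (size F)%:R - p x| <= e].
Proof.
move=> tK af; have aK := almost_periodic_trig tK; have [q [qK _]] := tK.
pose ct (t : (R * R) * V) y := f y * cos (dotp t.2 y).
pose st (t : (R * R) * V) y := f y * sin (dotp t.2 y).
pose al (t : (R * R) * V) x := t.1.1 * cos (dotp t.2 x) + t.1.2 * sin (dotp t.2 x).
pose be (t : (R * R) * V) x := t.1.1 * sin (dotp t.2 x) - t.1.2 * cos (dotp t.2 x).
have act t : almost_periodic (ct t).
  by apply: almost_periodicM => //; apply: almost_periodic_trig; exact: trig_cos.
have ast t : almost_periodic (st t).
  by apply: almost_periodicM => //; apply: almost_periodic_trig; exact: trig_sin.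
exists (fun x => \sum_(t <- q) (mean (ct t) * al t x + mean (st t) * be t x)).
  apply: trig_sum => t; apply: trigD; apply: trigZ.
    by apply: trigD; apply: trigZ; [exact: trig_cos|exact: trig_sin].
  apply: eq_trig (trigD (trigZ t.1.1 (trig_sin t.2)) (trigZ (- t.1.2) (trig_cos t.2))).
  by move=> x; rewrite /be mulNr.
move=> e e0.
(* Each coefficient error is multiplied by [al] or [be], both at most [|t.1.1| + |t.1.2|]; the added
   1 lets the same tolerance [e / C] serve the mean of [K]. *)
pose C : R := \sum_(t <- q) 2 * (`|t.1.1| + `|t.1.2|) + 1.
have C1 : 1 <= C by rewrite lerDr sumr_ge0 // => t _; rewrite mulr_ge0 // addr_ge0.
have C0 : 0 < C by apply: lt_le_trans C1.
have eC : 0 < e / C by rewrite divr_gt0.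
have [|F [F0 HF]] := @mean_approx_seq R V
    (K :: [seq ct t | t <- q] ++ [seq st t | t <- q]) _ _ eC.
  move=> g; rewrite inE mem_cat => /orP[/eqP -> //|/orP[] /mapP[t _ ->]].
    exact: act.
  exact: ast.
exists F; split=> //.
  have := HF K (mem_head _ _) 0; rewrite /avg (eq_bigr K) => [h|c _]; last by rewrite add0r.
  by apply: (le_trans h); rewrite ler_pdivrMr // ler_peMr // ltW.
move=> x.
have PE : (\sum_(c <- F) K c * f (x + c)) / (size F)%:R =
    \sum_(t <- q) (avg F (ct t) x * al t x + avg F (st t) x * be t x).
  transitivity (\sum_(c <- F) \sum_(t <- q)
      (ct t (x + c) * al t x + st t (x + c) * be t x) / (size F)%:R).
    rewrite mulr_suml; apply: eq_bigr => c _.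
    rewrite -qK /tp_re mulr_suml mulr_suml; apply: eq_bigr => t _.
    congr (_ / _); rewrite /ct /st /al /be.
    rewrite (_ : dotp t.2 c = dotp t.2 (x + c) - dotp t.2 x); last first.
      by rewrite dotpDr addrC addKr.
    by rewrite cosB sinB; ring.
  rewrite exchange_big; apply: eq_bigr => t _ /=.
  rewrite /avg mulrAC (mulrAC (\sum_(c <- F) st t (x + c))) -mulrDl -mulr_suml.
  by congr (_ / _); rewrite !mulr_suml -big_split.
rewrite PE -sumrB (le_trans (ler_norm_sum _ _ _)) //.
apply: (@le_trans _ _ (\sum_(t <- q) e / C * (2 * (`|t.1.1| + `|t.1.2|)))); last first.
  by rewrite -mulr_sumr mulrAC ler_pdivrMr // ler_pM2l // lerDl.
rewrite big_seq [leRHS]big_seq; apply: ler_sum => t tq.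
have h1 : `|avg F (ct t) x - mean (ct t)| <= e / C.
  by apply: HF; rewrite inE mem_cat map_f // orbT.
have h2 : `|avg F (st t) x - mean (st t)| <= e / C.
  by apply: HF; rewrite inE mem_cat (map_f st) // !orbT.
have b1 (a s : R) : `|s| <= 1 -> `|a * s| <= `|a|.
  by move=> s1; rewrite normrM ler_piMr.
have hal : `|al t x| <= `|t.1.1| + `|t.1.2|.
  rewrite (le_trans (ler_normD _ _)) // lerD //; apply: b1;
    [exact: cos_max|exact: sin_max].
have hbe : `|be t x| <= `|t.1.1| + `|t.1.2|.
  rewrite (le_trans (ler_normB _ _)) // lerD //; apply: b1;
    [exact: sin_max|exact: cos_max].
rewrite (_ : _ - _ = (avg F (ct t) x - mean (ct t)) * al t x +
  (avg F (st t) x - mean (st t)) * be t x); last by ring.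
rewrite (le_trans (ler_normD _ _)) // !normrM.
have -> : e / C * (2 * (`|t.1.1| + `|t.1.2|)) =
  e / C * (`|t.1.1| + `|t.1.2|) + e / C * (`|t.1.1| + `|t.1.2|) by ring.
by rewrite lerD // ler_pM.
Qed.

Lemma Ck_sum k (I : Type) (r : seq I) (G : I -> V -> R) :
  (forall i, Ck k (G i)) -> Ck k (fun x => \sum_(i <- r) G i x).
Proof.
move=> CG; elim: r => [|i r IH].
  rewrite (_ : (fun x => _) = fun=> 0); first exact: Ck_cst.
  by apply/funext => x; rewrite big_nil.
rewrite (_ : (fun x => _) = fun x => G i x + \sum_(i <- r) G i x).
  exact: Ck_add (CG i) IH.
by apply/funext => x; rewrite big_cons.
Qed.

Lemma hb_sum m (I : Type) (r : seq I) (a : I -> R) (G : I -> V -> R) :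
  (forall i, Ck (ipart m) (G i)) -> (forall i, hb m (a i) (G i)) ->
  hb m (\sum_(i <- r) a i) (fun x => \sum_(i <- r) G i x).
Proof.
move=> CG HG; elim: r => [|i r IH].
  rewrite big_nil (_ : (fun x => _) = fun=> 0); first exact: hb_cst0.
  by apply/funext => x; rewrite big_nil.
rewrite big_cons (_ : (fun x => _) = fun x => G i x + \sum_(i <- r) G i x).
  exact: hb_add (CG i) (Ck_sum r CG) (HG i) IH.
by apply/funext => x; rewrite big_cons.
Qed.

(** The Hoelder bound at [x], [y] is a sup-type bound on [dl s] of the displacement of [v] by
    [x - y], evaluated at [y]; both halves thus reduce to [dl_bound_limit]. *)
Lemma hb_limit m A v : Ck (ipart m) v ->
  (forall eta : R, 0 < eta -> exists u, [/\ Ck (ipart m) u, hb m A u &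
     forall x, `|u x - v x| <= eta]) -> hb m A v.
Proof.
move=> Cv H; split=> [s sk x|g0 s sk x y].
  apply: (dl_bound_limit Cv sk) => eta /H[u [Cu [Hu _] uv]].
  by exists u; split=> // y; exact: Hu.
have sk' : (size s <= ipart m)%N by rewrite sk.
pose c := x - y; have Cw := Ck_fsub (Ck_transl c Cv) Cv.
have E w : Ck (ipart m) w -> forall z,
    dl s (fsub (transl w c) w) z = dl s w (z + c) - dl s w z.
  by move=> Cw' z; rewrite (dl_fsub (Ck_transl c Cw') Cw' sk') dl_transl.
have xE : x = y + c by rewrite addrC subrK.
rewrite {1}xE -E //; apply: (dl_bound_limit Cw sk') => eta eta0.
have eta2 : 0 < eta / 2 by rewrite divr_gt0.
have [u [Cu [_ Hu] uv]] := H _ eta2.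
exists (fsub (transl u c) u); split=> [|z|z].
- exact: Ck_fsub (Ck_transl c Cu) Cu.
- by rewrite E //; have := Hu g0 s sk (z + c) z; rewrite [z + c]addrC addrK.
- rewrite /fsub /transl (_ : _ - _ = (u (z + c) - v (z + c)) - (u z - v z)); last by ring.
  by rewrite (le_trans (ler_normB _ _)) // [leRHS]splitr lerD.
Qed.

Lemma Cap_approx m f e : 0 <= m -> Cap m f -> 0 < e ->
  exists2 p, trig p & hb m e (fsub p f).
Proof.
move=> m0 Cf e0; pose e1 := e / 4; have e10 : 0 < e1 by rewrite divr_gt0.
have [Cmf tf] := (CapP m f).1 Cf; have [Ckf [A HA]] := (CmbP m f).1 Cmf.
have A0 := hb_ge0 HA.
have [Lam [kap kap1 HLam]] := bohr_space (balls_hball Ckf) tf (hball_cont0 Cf) e10.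
pose eps := e1 / (2 * A + 1).
have A1 : 0 < 2 * A + 1 by lra.
have eps0 : 0 < eps by rewrite divr_gt0.
have [K [tK K0 K1 Kbad]] := bohr_kernel Lam kap1 eps0.
have [p0 tp0 Hp0] := twisted_mean tK (Cap_almost_periodic Cf).
pose mu := mean K; have mu0 : 0 < mu by apply: lt_le_trans K1.
exists (fun x => mu^-1 * p0 x); first exact: trigZ.
have Cp : Ck (ipart m) (fun x => mu^-1 * p0 x).
  by have [/CmbP[]] := Cap_trig m0 (trigZ mu^-1 tp0).
have Cd c : Ck (ipart m) (fsub (transl f c) f) by exact: Ck_fsub (Ck_transl c Ckf) Ckf.
(* If some cosine is at most [kap], the kernel is at most [eps] and the displacement at most [2 A],
   costing [e1]; otherwise the displacement itself is at most [e1]. *)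
have hK c : hb m (K c * e1 + e1) (fun x => K c * fsub (transl f c) f x).
  have [good|bad] := pselect (exists2 l, l \in Lam & cos (dotp l c) <= kap).
    have h := hb_fsub (Ck_transl c Ckf) Ckf (hb_transl c HA) HA.
    apply: hb_le (hb_scale (K c) (Cd c) h); rewrite (ger0_norm (K0 c)).
    have := Kbad c good; rewrite /eps ler_pdivlMr // => hh.
    have := K0 c; nra.
  have h : hball m f e1 c.
    apply: HLam => l lL; rewrite ltNge; apply/negP => h; apply: bad; by exists l.
  apply: hb_le (hb_scale (K c) (Cd c) h); rewrite (ger0_norm (K0 c)); lra.
apply: hb_limit; first exact: Ck_fsub Cp Ckf.
(* Three demands: uniform error below [eta], [e2 * e1 <= e1], and [e2 * A <= e1]. With [mu >= 1] the
   total error is then at most [4 * e1 = e]. *)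
move=> eta eta0; pose e2 := Num.min eta (Num.min 1 (e1 / (A + 1))).
have A2 : 0 < A + 1 by lra.
have e20 : 0 < e2 by rewrite !lt_min eta0 ltr01 divr_gt0.
have [F [F0 FK Fp]] := Hp0 _ e20.
pose N : R := (size F)%:R; have N0 : 0 < N by rewrite ltr0n lt0n size_eq0.
pose W := (\sum_(c <- F) K c) / N.
pose S x := \sum_(c <- F) K c * fsub (transl f c) f x.
have CS : Ck (ipart m) S by apply: Ck_sum => c; apply: Ck_scale; exact: Cd.
have HS : hb m (\sum_(c <- F) (K c * e1 + e1)) S.
  apply: (@hb_sum m _ F (fun c => K c * e1 + e1) (fun c x => K c * fsub (transl f c) f x)).
    by move=> c; apply: Ck_scale; exact: Cd.
  exact: hK.
(* This is the weighted finite average of translates divided by [mu], minus [f]. The finite weights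
   average to [W] rather than [mu], which accounts for the second term. *)
exists (fun x => (N * mu)^-1 * S x + (W - mu) / mu * f x); split.
- exact: Ck_lin CS (Ck_scale _ Ckf).
- have := hb_lin (N * mu)^-1 CS (Ck_scale ((W - mu) / mu) Ckf) HS
    (hb_scale ((W - mu) / mu) Ckf HA).
  apply: hb_le.
  have -> : \sum_(c <- F) (K c * e1 + e1) = N * (W * e1 + e1).
    rewrite big_split /= -mulr_suml big_const_seq count_predT iter_addr_0.
    by rewrite -(mulr_natl e1) -/N /W; field; rewrite gt_eqF.
  have Nmu : 0 < (N * mu)^-1 by rewrite invr_gt0 mulr_gt0.
  have e2A : e2 * A <= e1.
    have : e2 <= e1 / (A + 1) by rewrite !ge_min lexx !orbT.
    by rewrite ler_pdivlMr //; nra.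
  have e21 : e2 <= 1 by rewrite !ge_min lexx !orbT.
  have Wm : W <= mu + e2 by move: FK; rewrite -/N -/W -/mu ler_distl => /andP[].
  rewrite (gtr0_norm Nmu) normrM normfV (gtr0_norm mu0).
  have -> : (N * mu)^-1 * (N * (W * e1 + e1)) + `|W - mu| / mu * A =
     (W * e1 + e1 + `|W - mu| * A) / mu by field; rewrite !gt_eqF.
  rewrite ler_pdivrMr //.
  have h1 : `|W - mu| * A <= e2 * A by rewrite ler_wpM2r.
  have h2 : W * e1 <= (mu + e2) * e1 by rewrite ler_pM2r.
  have -> : e = 4 * e1 by rewrite /e1; field.
  have h3 : e1 <= mu * e1 by rewrite ler_peMl // ltW.
  have h4 : e2 * e1 <= e1 by rewrite ler_piMl // ltW.
  lra.
- move=> x; rewrite /fsub.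
  have -> : (N * mu)^-1 * S x + (W - mu) / mu * f x - (mu^-1 * p0 x - f x) =
     mu^-1 * ((\sum_(c <- F) K c * f (x + c)) / N - p0 x).
    have -> : S x = \sum_(c <- F) K c * f (x + c) - N * W * f x.
      rewrite /S /W (mulrC N) divfK ?gt_eqF // mulr_suml -sumrB.
      by apply: eq_bigr => c _; rewrite /fsub /transl mulrBr.
    by field; rewrite !gt_eqF.
  rewrite normrM normfV (gtr0_norm mu0) mulrC ler_pdivrMr //.
  apply: (le_trans (Fp x)); apply: (@le_trans _ _ eta); first by rewrite ge_min lexx.
  by rewrite ler_peMr // ltW.
Qed.

End Approximation.

(** * Derivatives and closedness *)

Section Derivatives.
Variables (R : realType) (n : nat).
Local Notation V := 'rV[R]_n.
Implicit Types (f g h : V -> R) (s : seq 'I_n) (c : V) (m A e : R).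

(** At top order the Hoelder bound is part of [hb]; below it the next derivative is bounded and
    interpolation supplies the bound, whence the constant. *)
Lemma hb_dl m A h s : 0 <= m -> Ck (ipart m) h -> hb m A h ->
  (size s <= ipart m)%N -> hb (fpart m) ((n%:R + 2) * A) (dl s h).
Proof.
move=> m0 Ch Hh sk; have A0 := hb_ge0 Hh; case: Hh => H1 H2.
have AA : A <= (n%:R + 2) * A.
  by rewrite ler_peMl // -[leLHS]add0r lerD // ler1n.
rewrite /hb ipart_fpart // fpart_fpart //; split=> [t|g0 t].
  by rewrite leqn0 size_eq0 => /eqP -> x; apply: le_trans AA; exact: H1.
move=> /size0nil -> x y /=.
case: (ltngtP (size s) (ipart m)) sk => // sk _.
  apply: holder_interp; first exact: Ch.2.
  - by apply: H1; exact: ltnW.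
  - by move=> i z; apply: (H1 (i :: s)).
  - by have /andP[-> /ltW] := fpart_itv m0.
by apply: le_trans (H2 g0 s sk x y) _; rewrite ler_wpM2r // powR_ge0.
Qed.

Lemma Ck0_dl m f s : 0 <= m -> Ck (ipart m) f -> (size s <= ipart m)%N ->
  Ck (ipart (fpart m)) (dl s f).
Proof. by move=> m0 Cf sk; rewrite ipart_fpart //; apply: Ck_dl Cf; rewrite addn0. Qed.

Lemma dl_displacement m f s c : Ck (ipart m) f -> (size s <= ipart m)%N ->
  fsub (transl (dl s f) c) (dl s f) = dl s (fsub (transl f c) f).
Proof. by move=> Cf sk; rewrite (dl_fsub (Ck_transl c Cf) Cf sk) dl_transl. Qed.

Lemma Cap_dl m f s : 0 <= m -> Cap m f -> (size s <= ipart m)%N ->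
  Cap (fpart m) (dl s f).
Proof.
move=> m0 /CapP[/CmbP[Cf [A HA]] tf] sk; apply/CapP; split.
  apply/CmbP; split; first exact: Ck0_dl.
  by exists ((n%:R + 2) * A); exact: hb_dl.
have K0 : 0 < (n%:R + 2 : R) by rewrite ltr_wpDl.
apply: (totally_bounded_le K0 _ tf) => e c e0 Hc.
rewrite /hball (dl_displacement c Cf sk); apply: hb_dl => //.
exact: Ck_fsub (Ck_transl c Cf) Cf.
Qed.

Lemma seqs_upto (k : nat) : exists r : seq (seq 'I_n),
  forall s, (s \in r) = (size s <= k)%N.
Proof.
exists (flatten [seq [seq tval t | t <- enum {: l.-tuple 'I_n}] | l <- iota 0 k.+1]) => s.
apply/flatten_mapP/idP => [[l]|sk].
  by rewrite mem_iota add0n ltnS => lk /mapP[t _ ->]; rewrite size_tuple.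
exists (size s); first by rewrite mem_iota add0n ltnS.
by apply/mapP; exists (in_tuple s) => //; rewrite mem_enum.
Qed.

(** Each derivative comes with its own net; as there are finitely many lists of directions, one net
    of displacements serves them all. *)
Lemma Cap_of_dl m f : 0 <= m -> Cmb m f ->
  (forall s, (size s <= ipart m)%N -> Cap (fpart m) (dl s f)) -> Cap m f.
Proof.
move=> m0 Cf H; apply/CapP; split=> //; have [Ckf _] := (CmbP m f).1 Cf.
have [r Hr] := seqs_upto (ipart m).
have T := @totally_bounded_all R V _ r (fun s => hball (fpart m) (dl s f)).
have {}T : totally_bounded
    (fun e c => forall s, s \in r -> hball (fpart m) (dl s f) e c).
  apply: T => s; rewrite Hr => sk; first by apply: balls_hball; exact: Ck0_dl.
  by have /CapP[] := H s sk.
move=> e e0; have [cs Hcs] := T e e0; exists cs => c.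
have [c' c's Hc] := Hcs c; exists c' => //.
have {}Hc s : (size s <= ipart m)%N ->
    hb (fpart m) e (dl s (fsub (transl f (c - c')) f)).
  by move=> sk; rewrite -(dl_displacement _ Ckf sk); apply: Hc; rewrite Hr.
split=> [s sk x|g0 s sk x y]; first by have [h _] := Hc s sk; exact: (h [::]).
have [|_ h] := Hc s; first by rewrite sk.
by have := h _ [::]; rewrite fpart_fpart // ipart_fpart //; apply.
Qed.

Lemma Cap_iff_dpart m f : 0 <= m -> Cmb m f ->
  Cap m f <-> (forall b : 'I_n -> nat, (mlen b)%:R <= m -> Cap (fpart m) (dpart b f)).
Proof.
move=> m0 Cf; split=> [Hf b|H].
  by rewrite leq_ipart // => bm; apply: Cap_dl => //; rewrite size_mseq.
apply: Cap_of_dl => // s sk; have [Ckf _] := (CmbP m f).1 Cf.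
by rewrite (dl_dpart Ckf sk); apply: H; rewrite leq_ipart // mlen_mcount.
Qed.

Lemma Cap_closed m (u : nat -> V -> R) f : (forall j, Cap m (u j)) -> Cmb m f ->
  (fun j => hnorm m (fsub (u j) f)) @ \oo --> 0 -> Cap m f.
Proof.
move=> Cu Cf lim; apply: Cap_limit => // e e0.
have /cvgrPdist_lt/(_ _ e0)[N _ /(_ N (leqnn N))] := lim.
rewrite /= sub0r normrN => h; exists (u N) => //.
apply: hb_le (ltW (le_lt_trans (ler_norm _) h)) _.
by apply: hb_hnorm; apply: Cmb_fsub => //; case: (Cu N).
Qed.

Lemma Cap_trig_limit m f : 0 <= m -> Cap m f -> exists p : nat -> trigpoly R n,
  (forall j x, tp_im (p j) x = 0) /\
  (fun j => hnorm m (fsub (tp_re (p j)) f)) @ \oo --> 0.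
Proof.
move=> m0 Cf.
have H (j : nat) : exists p : trigpoly R n,
    (forall x, tp_im p x = 0) /\ hb m j.+1%:R^-1 (fsub (tp_re p) f).
  have j0 : 0 < j.+1%:R^-1 :> R by rewrite invr_gt0.
  have [g [p [pg p0]] Hg] := Cap_approx m0 Cf j0.
  by exists p; split=> //; rewrite (funext pg : tp_re p = g).
have [p Hp] := choice H; exists p; split=> [j|]; first exact: (Hp j).1.
apply/cvgrPdist_lt => e e0; have e2 : 0 < e / 2 by rewrite divr_gt0.
near=> j; rewrite sub0r normrN ger0_norm.
  apply: le_lt_trans (hnorm_le (Hp j).2) _.
  rewrite mulrC -ltr_pdivlMr //; near: j.
  exact: (near_infty_natSinv_lt (PosNum e2)).
apply: (@hb_ge0 _ _ m _ (fsub (tp_re (p j)) f)); apply: hb_hnorm; apply: Cmb_fsub.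
  by case: (Cap_tp_re (p j) m0).
by case: Cf.
Unshelve. all: by end_near.
Qed.

Lemma Cap_littleC m f : 0 <= m -> Cap m f -> littleC m f.
Proof.
move=> m0 Cf; split=> [|e e0]; first by case: Cf.
(* Passing from [p - f] to [f - p] goes through [hb], and the return to [hnorm] doubles the
   bound. *)
have [p [_ /cvgrPdist_lt/(_ (e / 4))]] := Cap_trig_limit m0 Cf.
rewrite divr_gt0 // => /(_ isT)[N _ /(_ N (leqnn N))] /=.
rewrite sub0r normrN => h; exists (tp_re (p N)); split; first exact: Cinfb_tp_re.
have Cp : Cmb m (tp_re (p N)) by case: (Cap_tp_re (p N) m0).
have Cpf : Cmb m (fsub (tp_re (p N)) f) by apply: Cmb_fsub => //; case: Cf.
have [Ck_ _] := (CmbP _ _).1 Cpf.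
have := hb_scale (- 1) Ck_ (hb_hnorm Cpf); rewrite normrN normr1 mul1r.
rewrite (_ : (fun x => _) = fsub f (tp_re (p N))); last first.
  by apply/funext => x; rewrite /fsub mulN1r opprB.
move=> /hnorm_le h2; apply: (le_lt_trans h2).
by have := ler_norm (hnorm m (fsub (tp_re (p N)) f)); lra.
Qed.

End Derivatives.

Theorem theorem2p7 (R : realType) (n : nat) (m : R) :
  (0 < n)%N -> 0 <= m ->
  [/\ (* C^m_ap is a linear subspace of C^m_b *)
      (forall f : 'rV[R]_n -> R, Cap m f -> Cmb m f),
      Cap m (fun _ : 'rV[R]_n => 0),
      (forall f g : 'rV[R]_n -> R, Cap m f -> Cap m g -> Cap m (fun x => f x + g x)),
      (forall (a : R) (f : 'rV[R]_n -> R), Cap m f -> Cap m (fun x => a * f x)) &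
      (* ... which is closed in C^m_b *)
      (forall (u : nat -> 'rV[R]_n -> R) (f : 'rV[R]_n -> R),
          (forall j, Cap m (u j)) -> Cmb m f ->
          (fun j => hnorm m (fsub (u j) f)) @ \oo --> 0 -> Cap m f) ] /\
  (* C^m_ap  <=  c^m_b  <=  C^m_b *)
  (forall f : 'rV[R]_n -> R, Cap m f -> littleC m f) /\
  (forall f : 'rV[R]_n -> R, littleC m f -> Cmb m f) /\
  (* equivalences *)
  (forall f : 'rV[R]_n -> R, Cmb m f ->
     (Cap m f <-> (forall b : 'I_n -> nat, (mlen b)%:R <= m ->
                     Cap (fpart m) (dpart b f))) /\
     (Cap m f <-> exists p : nat -> trigpoly R n,
        (forall j x, tp_im (p j) x = 0) /\
        (fun j => hnorm m (fsub (tp_re (p j)) f)) @ \oo --> 0)).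
Proof.
move=> n0 m0; split; first split.
- by move=> f [].
- exact: Cap_cst0.
- by move=> f g Cf Cg; rewrite addE; exact: Cap_lin.
- by move=> a f Cf; rewrite scaleE; apply: Cap_lin => //; exact: Cap_cst0.
- by move=> u f; exact: Cap_closed.
split; first by move=> f; exact: Cap_littleC.
split; first by move=> f [].
move=> f Cf; split; first exact: Cap_iff_dpart.
split=> [|[p [_ lim]]]; first exact: Cap_trig_limit.
by apply: Cap_closed Cf lim => j; exact: Cap_tp_re.
Qed.
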